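(* Let $w$ be a GT-word and let $p$ and $q$ be the longest palindromic prefix and the longest palindromic suffix, respectively, of the heart $v$ of $w$. Then $w$ is rich if and only if one of the following holds: (i) $p$ and $q$ are unseparated in $v$, i.e., $v=pq$, or $v=p=q$, or $p$ and $q$ overlap in $v$ (equivalently, $v$ is not of the form $puq$ with $u$ non-empty); (ii) $v=pxq$ where $x$ is a letter, $\mathrm{Alph}(p)\cap\mathrm{Alph}(q)\neq\emptyset$ and $x\in\mathrm{Alph}(p)\cup\mathrm{Alph}(q)$; (iii) $v=puq$ where $\mathrm{Alph}(p)\cap\mathrm{Alph}(q)=\emptyset$ and $u=u_1Zu_2$ for words $u_1,u_2,Z$, at least one of which is non-empty, with $\mathrm{Alph}(u_1)\subseteq\mathrm{Alph}(p)$, $\mathrm{Alph}(u_2)\subseteq\mathrm{Alph}(q)$, and $Z$ containing no letter of $p$ or of $q$.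
   Context: Words are finite sequences of letters; $|w|$ is the length and $\mathrm{Alph}(w)$ the set of letters of $w$. A factor is a contiguous subword. A palindrome is a word equal to its reversal; the empty word is a palindrome. A finite word $w$ is rich if it has exactly $|w|+1$ distinct palindromic factors (including the empty word). The factor complexity $C_w(n)$ is the number of distinct factors of $w$ of length $n$. A word $w$ with $|\mathrm{Alph}(w)|\ge 2$ is a GT-word (generalized trapezoidal word) if there exist positive integers $m\le M$ such that $C_w(0)=1$, $C_w(i)=|\mathrm{Alph}(w)|+i-1$ for $1\le i\le m$, $C_w(i+1)=C_w(i)$ for $m\le i\le M-1$, and $C_w(i+1)=C_w(i)-1$ for $M\le i\le |w|$ (with $C_w(|w|+1)=0$). Every non-empty word with one distinct letter is also a GT-word. Heart: for a non-empty word $w$, let $r$ be the longest (possibly empty) prefix of $w$ all of whose letters occur exactly once in $w$, and $s$ the longest (possibly empty) suffix of $w$ all of whose letters occur exactly once in $w$. If $|w|>|\mathrm{Alph}(w)|$, the heart of $w$ is the unique non-empty $v$ with $w=rvs$; otherwise the heart of $w$ is $w$. *)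

(* Defs.v *)
From mathcomp Require Import all_boot.

Set Implicit Arguments.
Unset Strict Implicit.
Unset Printing Implicit Defensive.

Section Words.
Variable T : eqType.
Implicit Types w u v p q : seq T.

Definition Alph w : seq T := undup w.

(* Duplicate-free list of the factors of w, including the empty word. *)
Definition factors w : seq (seq T) :=
  undup [seq take l (drop i w) | i <- iota 0 (size w).+1,
                                 l <- iota 0 (size w).+1].

Lemma mem_factors w u : (u \in factors w) = infix u w.
Proof.
rewrite mem_undup; apply/allpairsP/infixP => [[[i l] /= [_ _ ->]]|].
  exists (take i w), (drop l (drop i w)).
  by rewrite cat_take_drop cat_take_drop.
case=> s1 [s2 ->]; exists (size s1, size u); split.
- by rewrite mem_iota add0n !size_cat ltnS /= leq_addr.
- by rewrite mem_iota add0n !size_cat ltnS /= addnCA leq_addr.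
- by rewrite /= drop_size_cat // take_size_cat.
Qed.

Definition palindrome w : bool := rev w == w.

Definition rich w : bool :=
  size [seq u <- factors w | palindrome u] == (size w).+1.

Definition complexity w (n : nat) : nat :=
  size [seq u <- factors w | size u == n].

(* The last clause is C_w(i+1) = C_w(i) - 1, written without truncated
   subtraction. *)
Definition GT_word w : Prop :=
  size (Alph w) = 1 \/
  2 <= size (Alph w) /\
  exists m M : nat,
    [/\ 0 < m <= M,
        complexity w 0 = 1,
        forall i, 1 <= i <= m -> complexity w i = size (Alph w) + i - 1,
        forall i, m <= i <= M - 1 -> complexity w i.+1 = complexity w i &
        forall i, M <= i <= size w -> complexity w i = (complexity w i.+1).+1].

(* Meant for predicates P that hold of the empty word. *)
Definition longest_prefix (P : pred (seq T)) w : seq T :=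
  take (\max_(i < (size w).+1 | P (take i w)) i) w.

Definition longest_suffix (P : pred (seq T)) w : seq T :=
  drop (size w - \max_(i < (size w).+1 | P (drop (size w - i) w)) i) w.

Lemma longest_prefixP (P : pred (seq T)) w : P [::] ->
  [/\ prefix (longest_prefix P w) w, P (longest_prefix P w) &
      forall u, prefix u w -> P u -> size u <= size (longest_prefix P w)].
Proof.
move=> P0; rewrite /longest_prefix.
have P0' : P (take (ord0 : 'I_(size w).+1) w) by rewrite take0.
split; first exact: prefix_take.
  by rewrite (bigmax_eq_arg _ P0'); case: arg_maxnP.
move=> u /prefixP [t def_w] Pu.
have lt_u : size u < (size w).+1 by rewrite ltnS def_w size_cat leq_addr.
rewrite size_takel; last by apply/bigmax_leqP => i _; rewrite -ltnS.
apply: (@leq_bigmax_cond _ _ (fun i : 'I_(size w).+1 => nat_of_ord i)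
          (Ordinal lt_u)).
by rewrite /= def_w take_size_cat.
Qed.

Lemma longest_suffixP (P : pred (seq T)) w : P [::] ->
  [/\ suffix (longest_suffix P w) w, P (longest_suffix P w) &
      forall u, suffix u w -> P u -> size u <= size (longest_suffix P w)].
Proof.
move=> P0; rewrite /longest_suffix.
have P0' : P (drop (size w - (ord0 : 'I_(size w).+1)) w).
  by rewrite subn0 drop_size.
split; first exact: suffix_drop.
  by rewrite (bigmax_eq_arg _ P0'); case: arg_maxnP.
move=> u /suffixP [t def_w] Pu.
have lt_u : size u < (size w).+1 by rewrite ltnS def_w size_cat leq_addl.
rewrite size_drop subKn; last by apply/bigmax_leqP => i _; rewrite -ltnS.
apply: (@leq_bigmax_cond _ _ (fun i : 'I_(size w).+1 => nat_of_ord i)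
          (Ordinal lt_u)).
by rewrite /= def_w size_cat addnK drop_size_cat.
Qed.

Definition once_in w u : bool := all (fun x => count_mem x w == 1) u.

Definition heart w : seq T :=
  if size (Alph w) < size w then
    let r := longest_prefix (once_in w) w in
    let s := longest_suffix (once_in w) w in
    drop (size r) (take (size w - size s) w)
  else w.

Lemma heartE w : size (Alph w) < size w ->
  w = longest_prefix (once_in w) w ++ heart w ++ longest_suffix (once_in w) w
  /\ heart w <> [::].
Proof.
move=> ltw; rewrite /heart ltw.
have [/prefixP [r' wr] r1 _] := @longest_prefixP (once_in w) w isT.
have [/suffixP [s' ws] s1 _] := @longest_suffixP (once_in w) w isT.
set r := longest_prefix _ w in wr r1 *; set s := longest_suffix _ w in ws s1 *.
have -> : take (size w - size s) w = s'.
  by rewrite {1 2}ws size_cat addnK take_size_cat.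
have [x xw x1] : exists2 x, x \in w & count_mem x w != 1.
  apply/hasP; apply: contraLR ltw; rewrite ltn_size_undup negbK -all_predC.
  move/allP => w1; apply: count_mem_uniq => x.
  case: (boolP (x \in w)) => [/w1 /negPn /eqP -> //|].
  by move/count_memPn.
have notin u : once_in w u -> x \notin u.
  by move=> /allP u1; apply: contraNN x1 => /u1.
have lt_rs : size r < size s'.
  rewrite ltnNge; apply: contraL xw => le_s'r.
  rewrite ws mem_cat negb_or (notin _ s1) andbT.
  apply: contra (notin _ r1); suff -> : s' = take (size s') r by exact: mem_take.
  have := congr1 (take (size s')) ws.
  by rewrite take_size_cat // {1}wr takel_cat.
have def_r : take (size r) s' = r.
  have := congr1 (take (size r)) wr.
  by rewrite take_size_cat // {1}ws takel_cat // ltnW.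
split; first by rewrite catA -{1}def_r cat_take_drop.
by move/(congr1 size)/eqP; rewrite size_drop subn_eq0 leqNgt lt_rs.
Qed.

(* The occurrences of p as a prefix and of q as a suffix of v are adjacent,
   are both all of v, or share the non-empty factor z. *)
Definition unseparated p q v : Prop :=
  [\/ v = p ++ q,
      v = p /\ v = q |
      exists x z y, [/\ z <> [::], v = x ++ z ++ y, p = x ++ z & q = z ++ y]].

Definition share_letter u v : Prop :=
  exists x : T, x \in Alph u /\ x \in Alph v.

End Words.

(* Main.v *)
Require Import Defs.
From mathcomp Require Import all_boot zify.

(* A word is rich iff each of its prefixes has a palindromic suffix that does
   not occur earlier.  The heart v of a GT-word satisfies C(n+1) <= C(n) + 1 for
   n >= 1, and its first and last letters recur; hence its non-empty right
   special factors form a chain for the suffix order and have two extensions.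
   Two situations arise.
   - Some letter a (a hub) belongs to every factor of length 2.  Deleting one a
     after each other letter gives a shorter word over at most two letters with
     the same chain property.  This operation preserves and reflects palindromes,
     so by induction v is rich, and a palindromic prefix and a palindromic suffix
     cover v, up to one letter a when v neither begins nor ends with a.
   - There is no hub.  Then every palindromic factor alternates between two
     letters, so richness bounds the distance between consecutive occurrences of
     a letter by 2.  If v is rich, the letters of p fill an initial block of v and
     those of q a final block, which is (i) or (iii).  Conversely, p and q cannot
     share a letter when they contain all the letters of v, unless v is binary, and
     a word made of blocks with disjoint alphabets is rich as soon as each block
     is. *)

Set Implicit Arguments.
Unset Strict Implicit.
Unset Printing Implicit Defensive.

(** * Rich words *)

Section Richness.
Variable T : eqType.
Implicit Types (x y a : T) (u v w p q s t : seq T).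

Lemma cat_eq_split s1 t1 s2 t2 : s1 ++ t1 = s2 ++ t2 -> size s1 <= size s2 ->
  exists2 d, s2 = s1 ++ d & t1 = d ++ t2.
Proof.
move=> E le; exists (drop (size s1) s2).
  have := congr1 (take (size s1)) E; rewrite take_size_cat // takel_cat // => {1}->.
  by rewrite cat_take_drop.
have := congr1 (drop (size s1)) E; rewrite drop_size_cat // drop_cat.
by case: ltngtP le => // -> _; rewrite subnn drop0 drop_size.
Qed.

Lemma suffix_common p q w :
  suffix p w -> suffix q w -> size p <= size q -> suffix p q.
Proof.
case/suffixP=> s1 -> /suffixP [s2 E] le.
have [|d _ ->] := cat_eq_split (esym E); last exact: suffix_suffix.
by have := congr1 size E; rewrite !size_cat; lia.
Qed.

Lemma palindrome_rev u : palindrome (rev u) = palindrome u.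
Proof. by rewrite /palindrome revK eq_sym. Qed.

Definition new_pal w x : pred (seq T) := fun p =>
  [&& suffix p (rcons w x), palindrome p & ~~ infix p w].

(** The shorter of two palindromic suffixes is a suffix, hence by reversal also a prefix, of the
    longer one; unless they are equal, it already occurs in [w]. *)
Lemma new_pal_uniq w x p q : new_pal w x p -> new_pal w x q -> p = q.
Proof.
wlog le_pq : p q / size p <= size q.
  move=> H np nq; case: (leqP (size p) (size q)) => [le|/ltnW le].
    exact: H.
  by apply/esym/H.
case/and3P=> sp /eqP pp npw /and3P [sq /eqP pq _].
have pre : prefix p q.
  by rewrite -suffix_rev pp pq (suffix_common sp sq).
case/prefixP: pre => t Eq; case/lastP: t Eq => [|t y Eq].
  by rewrite cats0.
case/negP: npw; case/suffixP: sq => s2; rewrite Eq -!rcons_cat => /rcons_inj [-> _].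
exact: infix_infix.
Qed.

Definition pals w := [seq u <- factors w | palindrome u].

Lemma mem_pals w u : (u \in pals w) = palindrome u && infix u w.
Proof. by rewrite mem_filter mem_factors. Qed.

Lemma uniq_pals w : uniq (pals w).
Proof. by rewrite filter_uniq ?undup_uniq. Qed.

Lemma pals_rcons_new w x p : new_pal w x p -> size (pals (rcons w x)) = (size (pals w)).+1.
Proof.
move=> np; suff/perm_size -> : perm_eq (pals (rcons w x)) (p :: pals w) by [].
apply: uniq_perm; rewrite /= ?uniq_pals // ?andbT.
  by case/and3P: np => _ _; rewrite mem_pals negb_and orbC => ->.
move=> q; rewrite inE !mem_pals infix_rconsl.
case: (boolP (infix q w)) => [qw|nqw]; rewrite ?(orbT, orbF, andbT, andbF).
  by case: eqP => // ->; case/and3P: np.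
apply/andP/eqP => [[pq sq]|->]; last by case/and3P: np.
by apply: new_pal_uniq np; apply/and3P.
Qed.

Lemma pals_rcons_old w x : (forall p, ~~ new_pal w x p) ->
  size (pals (rcons w x)) = size (pals w).
Proof.
move=> np; apply/perm_size/uniq_perm; rewrite ?uniq_pals // => q.
rewrite !mem_pals infix_rconsl; have := np q; rewrite /new_pal.
by case: suffix; case: palindrome; case: infix.
Qed.

Lemma new_palVold w x : (exists p, new_pal w x p) \/ (forall p, ~~ new_pal w x p).
Proof.
case: (boolP (has (new_pal w x) (factors (rcons w x)))) => [/hasP [p _ np]|/hasPn np].
  by left; exists p.
right=> p; case: (boolP (suffix p (rcons w x))) => [sp|nsp].
  by apply: np; rewrite mem_factors suffixW.
by rewrite /new_pal negb_and nsp.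
Qed.

Lemma size_pals w : size (pals w) <= (size w).+1.
Proof.
elim/last_ind: w => // w x IH; rewrite size_rcons.
case: (new_palVold w x) => [[p /pals_rcons_new ->]|/pals_rcons_old ->] //.
exact: leqW.
Qed.

Lemma rich_pals w : rich w = (size (pals w) == (size w).+1).
Proof. by []. Qed.

Lemma rich_nil : rich ([::] : seq T).
Proof. by []. Qed.

(** Each appended letter adds at most one palindrome, so the bound [size_pals] is attained only with
    a gain at every letter. *)
Lemma rich_rcons w x : rich (rcons w x) <-> rich w /\ exists p, new_pal w x p.
Proof.
rewrite !rich_pals size_rcons; have := size_pals w.
case: (new_palVold w x) => [[p np]|np] le.
  by rewrite (pals_rcons_new np) eqSS; split=> [->|[]] //; split=> //; exists p.
rewrite (pals_rcons_old np); split=> [/eqP E|[_ [p]]]; first by lia.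
by rewrite (negPf (np p)).
Qed.

Lemma rich_rev w : rich (rev w) = rich w.
Proof.
rewrite !rich_pals size_rev; congr (_ == _); apply/perm_size/uniq_perm => [||u].
- exact: uniq_pals.
- exact: uniq_pals.
- rewrite !mem_pals; case: (boolP (palindrome u)) => //= /eqP pu.
  by rewrite -{1}pu infix_rev.
Qed.

Lemma rich_catl s t : rich (s ++ t) -> rich s.
Proof.
elim/last_ind: t => [|t x IH]; first by rewrite cats0.
by rewrite -rcons_cat => /rich_rcons [/IH].
Qed.

Lemma rich_infix u w : infix u w -> rich w -> rich u.
Proof.
case/infixP=> s [t ->]; rewrite -rich_rev rev_cat => /rich_catl.
rewrite rich_rev; exact: rich_catl.
Qed.

Lemma infix_cat_disjoint p s t :
  (forall x, x \in p -> x \notin s) -> infix p (s ++ t) -> infix p t.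
Proof.
elim: s => //= x s IH dis /orP [{IH}|/IH]; last first.
  by apply=> y /dis; rewrite inE negb_or => /andP [].
case: p dis => [|y p] dis; first by rewrite infix0s.
by case/andP=> /eqP E _; have := dis y (mem_head _ _); rewrite E mem_head.
Qed.

(** The palindrome that a letter of [t] creates consists of letters of [t]; as these are absent from
    [s], it has no earlier occurrence in [s ++ t] either. *)
Lemma rich_cat s t :
  (forall x, x \in s -> x \notin t) -> rich s -> rich t -> rich (s ++ t).
Proof.
move=> + rs; elim/last_ind: t => [|t x IH] dis; first by rewrite cats0.
case/rich_rcons => rt [p /and3P [sp pp np]].
rewrite -rcons_cat; apply/rich_rcons; split.
  by apply: IH => // y /dis; rewrite mem_rcons inE negb_or => /andP [].
exists p; apply/and3P; split=> //; first by rewrite rcons_cat suffix_catr.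
apply: contra np; apply: infix_cat_disjoint => y yp.
by apply/negP => /dis; rewrite (mem_infix (suffixW sp) yp).
Qed.

Lemma rich_uniq s : uniq s -> rich s.
Proof.
elim/last_ind: s => // s x IH; rewrite rcons_uniq => /andP [xs /IH rs].
apply/rich_rcons; split=> //; exists [:: x]; rewrite /new_pal infix1s xs andbT.
by rewrite -cats1 suffix_suffix /palindrome /rev /= eqxx.
Qed.

Lemma rich_nseq k x : rich (nseq k x).
Proof.
elim: k => [|k IH]; first exact: rich_nil.
have E: rcons (nseq k x) x = nseq k.+1 x by rewrite -cats1 -(nseqD _ 1) addn1.
rewrite -E.
apply/rich_rcons; split=> //; exists (nseq k.+1 x).
rewrite /new_pal E suffix_refl /palindrome rev_nseq eqxx /=.
by apply/negP => /size_infix; rewrite /= size_nseq ltnn.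
Qed.

(* The palindromic suffix that is new at the last letter of [a t a] starts at
   the first occurrence of [a]: otherwise it is the letter [a] itself. *)
Lemma rich_return a t : rich (a :: rcons t a) -> a \notin t -> palindrome t.
Proof.
rewrite -rcons_cons => /rich_rcons [_ [p /and3P [/suffixP [s E] /eqP pp np]]] nat.
case/lastP: p => [|p y] in E pp np *; first by rewrite infix0s in np.
move: E; rewrite -rcons_cat => /rcons_inj [E ?]; subst y.
case: p => [|z p] in E pp np *; first by rewrite infix1s mem_head in np.
move: pp; rewrite rev_rcons /= => -[Ez pp]; subst z.
case: s => [|z s] in E *.
  case: E => ->; move: pp; rewrite rev_cons => /rcons_inj [pp].
  by rewrite /palindrome pp.
by case: E nat => _ ->; rewrite mem_cat mem_head orbT.
Qed.

End Richness.

(** * Factor complexity *)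

Section Complexity.
Variable T : eqType.
Implicit Types (x y a : T) (u v w p q s t f g h : seq T).

Definition nfactors w n := [seq u <- factors w | size u == n].

Lemma mem_nfactors w n u : (u \in nfactors w n) = (size u == n) && infix u w.
Proof. by rewrite mem_filter mem_factors. Qed.

Lemma uniq_nfactors w n : uniq (nfactors w n).
Proof. by rewrite filter_uniq ?undup_uniq. Qed.

Lemma complexityE w n : complexity w n = size (nfactors w n).
Proof. by []. Qed.

Lemma complexity_rev w n : complexity (rev w) n = complexity w n.
Proof.
suff le u : complexity u n <= complexity (rev u) n.
  by apply/eqP; rewrite eqn_leq le andbT -{2}[w]revK le.
rewrite !complexityE -(size_map rev (nfactors u n)).
apply: uniq_leq_size; first by rewrite (map_inj_uniq (can_inj revK)) uniq_nfactors.
by move=> _ /mapP [t + ->]; rewrite !mem_nfactors size_rev infix_rev.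
Qed.

Lemma complexity_gt w n : size w < n -> complexity w n = 0.
Proof.
move=> lt; rewrite complexityE; case E: (nfactors w n) => [//|u s].
have: u \in nfactors w n by rewrite E mem_head.
by rewrite mem_nfactors => /andP [/eqP Eu /size_infix]; lia.
Qed.

Definition slow_growth w := forall n, 0 < n -> complexity w n.+1 <= (complexity w n).+1.

Lemma slow_growth_rev w : slow_growth w -> slow_growth (rev w).
Proof. by move=> sg n; rewrite !complexity_rev; apply: sg. Qed.

Lemma slow_growth_unary w : size (Alph w) <= 1 -> slow_growth w.
Proof.
move=> A1 n _; apply: (@leq_trans 1) => //; rewrite complexityE.
case: w A1 => [|a w] A1.
  by rewrite -complexityE complexity_gt.
have wE x : x \in a :: w -> x = a.
  move=> xw; have: uniq [:: x; a] = false.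
    apply/negP => /uniq_leq_size /(_ (_ : {subset _ <= Alph (a :: w)})) le.
    by move: A1; rewrite leqNgt => /negP; apply; apply: le => y;
       rewrite !inE mem_undup => /orP [] /eqP -> //; rewrite mem_head.
  by rewrite /= inE andbT => /negbFE /eqP.
apply: (@uniq_leq_size _ _ [:: nseq n.+1 a]); first exact: uniq_nfactors.
move=> u; rewrite mem_nfactors inE => /andP [/eqP <- /mem_infix uw].
by apply/eqP/all_pred1P/allP => x /uw /wE ->; rewrite /= eqxx.
Qed.

Lemma GT_slow_growth w : GT_word w -> slow_growth w.
Proof.
case=> [A1|[A2 [m [M [/andP [m0 mM] C0 up flat down]]]]].
  by apply: slow_growth_unary; rewrite A1.
move=> n n0; case: (ltnP n m) => [nm|mn].
  by rewrite !up; lia.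
case: (ltnP n M) => [nM|Mn]; first by rewrite flat; lia.
case: (leqP n (size w)) => [nw|wn]; first by rewrite (down n); lia.
by rewrite complexity_gt; lia.
Qed.

(** As [x] does not occur in [v], the prefix of length [n] is the only factor of that length that
    [v] lacks. *)
Lemma complexity_cons x v n : x \notin v -> 0 < n <= (size v).+1 ->
  complexity (x :: v) n = (complexity v n).+1.
Proof.
move=> xv /andP [n0 nv]; rewrite !complexityE.
suff/perm_size -> : perm_eq (nfactors (x :: v) n) (take n (x :: v) :: nfactors v n) by [].
have szt : size (take n (x :: v)) = n by rewrite size_takel.
apply: uniq_perm; rewrite /= ?uniq_nfactors // ?andbT.
  rewrite mem_nfactors szt eqxx /=; apply: contra xv => /mem_infix; apply.
  by case: n {nv szt} n0 => //= n; rewrite mem_head.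
move=> u; rewrite inE !mem_nfactors infix_consl prefixE.
case: eqP => [->|/eqP/negPf ne] /=; first by rewrite eq_sym.
by rewrite orbF; apply/esym/eqP => E; rewrite E szt eqxx in ne.
Qed.

Lemma slow_growth_cons x v : x \notin v -> slow_growth (x :: v) -> slow_growth v.
Proof.
move=> xv sg n n0; case: (leqP n (size v)) => nv; last first.
  by rewrite complexity_gt // ltnS ltnW.
by have := sg n n0; rewrite !complexity_cons //; lia.
Qed.

Lemma slow_growth_catr s v : uniq s -> (forall x, x \in s -> x \notin v) ->
  slow_growth (s ++ v) -> slow_growth v.
Proof.
elim: s => //= x s IH /andP [xs us] dis /slow_growth_cons sg.
apply: IH => // [y ys|]; first by apply: dis; rewrite inE ys orbT.
by apply: sg; rewrite mem_cat negb_or xs dis ?mem_head.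
Qed.

End Complexity.

(** * The heart *)

Section Heart.
Variable T : eqType.
Implicit Types (x y a : T) (u v w p q s t f g h r : seq T).

Lemma once_in_cat s t : once_in (s ++ t) s ->
  uniq s /\ forall x, x \in s -> x \notin t.
Proof.
move/allP=> s1.
have cs x : x \in s -> count_mem x s = 1 /\ count_mem x t = 0.
  by move=> xs; have := s1 x xs; rewrite count_cat -has_pred1 has_count in xs *; lia.
split=> [|x /cs [_ /eqP]]; last by rewrite -leqn0 leqNgt -has_count has_pred1.
apply: count_mem_uniq => x; case: (boolP (x \in s)) => [/cs [] //|].
by move/count_memPn.
Qed.

Lemma once_in_perm u v s : perm_eq u v -> once_in u s = once_in v s.
Proof. by move=> /permP uv; apply: eq_all => x; rewrite uv. Qed.

Definition head_recurs v := forall x t, v = x :: t -> x \in t.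

(** If the first letter of [v] did not recur, it would occur once in the whole word, and [r] could
    be prolonged by it. *)
Lemma head_recurs_heart r v s : once_in (r ++ v ++ s) r -> once_in (r ++ v ++ s) s ->
  (forall u, prefix u (r ++ v ++ s) -> once_in (r ++ v ++ s) u -> size u <= size r) ->
  head_recurs v.
Proof.
move=> r1 s1 max x t Ev; apply/negPn/negP => xt.
set w := r ++ v ++ s in r1 s1 max.
have xr : x \notin r.
  apply/negP => xr; have [_ /(_ x xr)] := once_in_cat r1.
  by rewrite mem_cat Ev mem_head.
have xs : x \notin s.
  apply/negP => xs; have [_ /(_ x xs)] : uniq s /\ forall x, x \in s -> x \notin r ++ v.
    apply: once_in_cat; rewrite -(once_in_perm _ (_ : perm_eq w _)) //.
    by rewrite /w catA perm_catC.
  by rewrite mem_cat Ev mem_head orbT.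
have /max : prefix (rcons r x) w by rewrite /w Ev -cats1 prefix_catr //= !eqxx prefix0s.
rewrite size_rcons ltnn => H; suff /H : once_in w (rcons r x) by [].
rewrite /once_in all_rcons -/(once_in w r) r1 andbT.
rewrite /w Ev !count_cat /= eqxx.
by move/count_memPn: xr => ->; move/count_memPn: xs => ->; move/count_memPn: xt => ->.
Qed.

(** The letters of [r] and [s] are distinct and absent from [v]: stripping them one by one keeps the
    growth bound, and putting them back keeps richness by [rich_cat]. *)
Lemma heart_reduction w v : slow_growth w -> size (Alph w) < size w -> v = heart w ->
  [/\ v <> [::], slow_growth v, head_recurs v, head_recurs (rev v) & rich w = rich v].
Proof.
move=> sg ltw Ev; have [Ew v0] := heartE ltw; rewrite -Ev in Ew v0.
have [_ r1 rmax] := @longest_prefixP T (once_in w) w isT.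
have [_ s1 smax] := @longest_suffixP T (once_in w) w isT.
move: (longest_prefix _ _) (longest_suffix _ _) Ew r1 rmax s1 smax => r s Ew r1 rmax s1 smax.
subst w; have [ur dr] := once_in_cat r1.
have pe u : perm_eq (r ++ u ++ s) (rev s ++ rev u ++ rev r).
  by rewrite -!rev_cat -catA perm_sym perm_rev.
have s1' : once_in (rev s ++ rev v ++ rev r) (rev s).
  by rewrite -(once_in_perm _ (pe v)) /once_in all_rev.
have [us ds] := once_in_cat s1'; rewrite rev_uniq in us.
split=> //.
- rewrite -[v]revK; apply/slow_growth_rev.
  have /slow_growth_rev := slow_growth_catr ur dr sg.
  rewrite rev_cat; apply: slow_growth_catr; rewrite ?rev_uniq // => x /ds.
  by rewrite mem_cat negb_or => /andP [].
- exact: head_recurs_heart r1 s1 rmax.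
- apply: head_recurs_heart s1' _ _.
    by rewrite -(once_in_perm _ (pe v)) /once_in all_rev.
  move=> u; rewrite -!rev_cat -catA -suffix_revLR => /smax.
  rewrite !size_rev => H u1; apply: H; move: u1.
  by rewrite (once_in_perm _ (_ : perm_eq _ (r ++ v ++ s))) ?perm_rev // /once_in all_rev.
apply/idP/idP; first by apply: rich_infix; apply: infix_infix.
move=> rv; apply: rich_cat => //; first exact: rich_uniq.
apply: rich_cat => //; last exact: rich_uniq.
move=> x xv; apply/negP => xs; have := ds x; rewrite mem_rev => /(_ xs).
by rewrite mem_cat mem_rev xv.
Qed.

End Heart.

(** * Special factors *)

Section SpecialFactors.
Variable T : eqType.
Implicit Types (x y a b c d e : T) (u v w p q s t f g h r z : seq T).

Definition special w f := exists c d, [/\ c <> d, infix (rcons f c) w & infix (rcons f d) w].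

Section Counting.
Variables (w : seq T) (n : nat).
Hypothesis slow : complexity w n.+1 <= (complexity w n).+1.
Hypothesis extend : forall f, infix f w -> size f = n -> exists c, infix (rcons f c) w.

(** Chooses one right extension of each factor of length [n]; by [extend], the default [f] is never
    reached on such factors. *)
Let ext f := head f [seq z <- nfactors w n.+1 | take n z == f].

Let ext_mem f : f \in nfactors w n -> (ext f \in nfactors w n.+1) /\ take n (ext f) = f.
Proof.
rewrite mem_nfactors => /andP [/eqP sf fw].
suff: ext f \in [seq z <- nfactors w n.+1 | take n z == f].
  by rewrite mem_filter => /andP [/eqP].
have [c fc] := extend fw sf; rewrite /ext; move: (ext f).
have: rcons f c \in [seq z <- nfactors w n.+1 | take n z == f].
  by rewrite mem_filter mem_nfactors size_rcons sf fc -cats1 take_size_cat // !eqxx.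
by case: [seq _ <- _ | _] => // z s _ _; rewrite mem_head.
Qed.

(** [take n] inverts [ext], so the values of [ext] account for [complexity w n] factors of length
    [n.+1], and [slow] leaves room for at most one more. *)
Let one_surplus z1 z2 : z1 \in nfactors w n.+1 -> z2 \in nfactors w n.+1 ->
  z1 <> ext (take n z1) -> z2 <> ext (take n z2) -> z1 = z2.
Proof.
move=> m1 m2 n1 n2; apply/eqP/negPn/negP => ne.
have nm z : z <> ext (take n z) -> z \notin [seq ext f | f <- nfactors w n].
  move=> nz; apply/negP => /mapP [f /ext_mem [_ E] Ez].
  by apply: nz; rewrite {2}Ez E.
have: uniq (z1 :: z2 :: [seq ext f | f <- nfactors w n]).
  rewrite /= inE negb_or ne !nm //= map_inj_in_uniq ?uniq_nfactors //.
  by move=> f g /ext_mem [_ Ef] /ext_mem [_ Eg] E; rewrite -Ef E Eg.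
move/uniq_leq_size => /(_ (nfactors w n.+1)) le.
move: slow; rewrite leqNgt; apply/negP; rewrite negbK !complexityE.
rewrite -(size_map ext (nfactors w n)); apply: le => z; rewrite !inE.
by case/or3P => [/eqP -> //|/eqP -> //|/mapP [f /ext_mem [+ _] ->]].
Qed.

Let surplus f c d : size f = n -> c <> d -> infix (rcons f c) w -> infix (rcons f d) w ->
  exists2 x, x \in [:: c; d] & rcons f x <> ext f /\ rcons f x \in nfactors w n.+1.
Proof.
move=> sf cd fc fd; case: (eqVneq (rcons f c) (ext f)) => [E|/eqP ne].
  exists d; rewrite ?inE ?eqxx ?orbT // mem_nfactors size_rcons sf eqxx fd.
  by rewrite -E; split=> // /rcons_inj [] Ed; apply: cd.
by exists c; rewrite ?mem_head // mem_nfactors size_rcons sf eqxx fc.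
Qed.

(** Of two extensions of a special word, one is not the chosen one; it is the surplus factor, and
    the special word is its prefix. *)
Lemma special_inj f g : size f = n -> size g = n -> special w f -> special w g -> f = g.
Proof.
move=> sf sg [c [d [cd fc fd]]] [c' [d' [cd' gc gd]]].
have [x _ [nx mx]] := surplus sf cd fc fd.
have [y _ [ny my]] := surplus sg cd' gc gd.
have tk h e : size h = n -> take n (rcons h e) = h.
  by move=> <-; rewrite -cats1 take_size_cat.
by have := one_surplus mx my; rewrite !tk // => /(_ nx ny) /rcons_inj [].
Qed.

Lemma special_degree f c1 c2 c3 : size f = n ->
  infix (rcons f c1) w -> infix (rcons f c2) w -> infix (rcons f c3) w ->
  [|| c1 == c2, c1 == c3 | c2 == c3].
Proof.
move=> sf f1 f2 f3; apply/negPn/negP; rewrite !negb_or => /and3P [/eqP n12 /eqP n13 /eqP n23].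
have [x x12 [nx mx]] := surplus sf n12 f1 f2.
have tk e : take n (rcons f e) = f by rewrite -cats1 take_size_cat.
have [y yx [ny my]] : exists2 y, y <> x & rcons f y <> ext f /\ rcons f y \in nfactors w n.+1.
  case: (eqVneq x c1) => [->|/eqP nx1].
    have [y y23 ?] := surplus sf n23 f2 f3; exists y => // Ey.
    by move: y23; rewrite !inE Ey => /orP [] /eqP.
  have Ex : x = c2 by move: x12; rewrite !inE => /orP [] /eqP.
  have [y y13 ?] := surplus sf n13 f1 f3; exists y => // Ey.
  by move: y13; rewrite !inE Ey Ex => /orP [] /eqP; auto.
by have := one_surplus mx my; rewrite !tk // => /(_ nx ny) /rcons_inj [] /esym.
Qed.

End Counting.

(** Suffixes of special words are special, so this leaves at most one special word of each length;
    with [h] empty, at most one special letter. *)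
Definition special_chain v :=
  forall h e1 e2, special v (e1 :: h) -> special v (e2 :: h) -> e1 = e2.

Definition degree_le2 v := forall x c1 c2 c3,
  infix [:: x; c1] v -> infix [:: x; c2] v -> infix [:: x; c3] v ->
  [|| c1 == c2, c1 == c3 | c2 == c3].

Lemma special_consl v e f : special v (e :: f) -> special v f.
Proof.
move=> [c [d [ne fc fd]]]; exists c, d.
by split=> //; [apply: consl_infix fc|apply: consl_infix fd].
Qed.

Lemma special_infix u v f : infix u v -> special u f -> special v f.
Proof.
by move=> uv [c [d [cd fc fd]]]; exists c, d; split=> //;
   [apply: infix_trans fc uv|apply: infix_trans fd uv].
Qed.

Lemma special_chain_infix u v : infix u v -> special_chain v -> special_chain u.
Proof. by move=> uv ch h e1 e2 /(special_infix uv) s1 /(special_infix uv); apply: ch. Qed.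

(** Only the suffix of length [n] can lack a following letter, and the hypothesis supplies another
    occurrence of it, followed by [c]. *)
Lemma suffix_extends v n c : n <= size v -> infix (rcons (drop (size v - n) v) c) v ->
  forall f, infix f v -> size f = n -> exists c, infix (rcons f c) v.
Proof.
move=> nv tc f /infixP [s [[|d t] E]] sf; last first.
  by exists d; apply/infixP; exists s, t; rewrite cat_rcons.
exists c; move: tc; rewrite E cats0 size_cat sf addnK drop_size_cat //.
Qed.

Lemma head_recurs_extends v : head_recurs (rev v) ->
  forall f, infix f v -> size f = 1 -> exists c, infix (rcons f c) v.
Proof.
move=> hr f fv sf; case/lastP: v => [|v x] in hr fv *.
  by move: fv; rewrite infixs0 => /eqP Ef; rewrite Ef in sf.
have xv : x \in v by rewrite -mem_rev; apply: hr; rewrite rev_rcons.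
suff [c xc] : exists c, infix (rcons [:: x] c) (rcons v x).
  apply: suffix_extends fv sf; first by rewrite size_rcons.
  by rewrite size_rcons subn1 /= drop_rcons // drop_size; apply: xc.
have /infixP [s [t ->]] : infix [:: x] v by rewrite infix1s.
case: t => [|c t]; first by exists x; rewrite cats0 cats1 -!cats1 -catA suffix_infix.
by exists c; rewrite rcons_cat infix_catl //= !eqxx prefix0s.
Qed.

Lemma special_chain_inj v m :
  (forall h e1 e2, size h < m -> special v (e1 :: h) -> special v (e2 :: h) -> e1 = e2) ->
  forall f g, size f = size g -> size f <= m -> special v f -> special v g -> f = g.
Proof.
move=> ch; elim=> [|a f IH] [|b g] //= [sz] lt sf sg.
have E : f = g by apply: IH (special_consl sf) (special_consl sg) => //; apply: ltnW.
by rewrite -E in sg *; congr (_ :: _); apply: ch sf sg.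
Qed.

Lemma prefix_or_split s t : size s <= size t ->
  prefix s t \/ exists r x y s' t', [/\ s = r ++ x :: s', t = r ++ y :: t' & x <> y].
Proof.
elim: s t => [|x s IH] [|y t] //=; try by left.
move=> /IH; case: (eqVneq x y) => [->|/eqP ne] H; last first.
  by right; exists [::], x, y, s, t.
case: H => [|[r [x' [y' [s' [t' [-> -> ?]]]]]]]; first by left.
by right; exists (y :: r), x', y', s', t'.
Qed.

Lemma last_occurrence v h c : infix (rcons h c) v ->
  exists s x t, v = s ++ rcons h x ++ t /\
    forall s' x' t', v = s' ++ rcons h x' ++ t' -> size s' <= size s.
Proof.
pose P i := prefix h (drop i v) && (i + size h < size v).
have PP s x t : v = s ++ rcons h x ++ t -> P (size s).
  move=> E; rewrite /P {1}E drop_size_cat // cat_rcons prefix_prefix /=.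
  by rewrite E !size_cat size_rcons; lia.
case/infixP=> s0 [t0 /PP Ps0]; have exP : exists i, P i by exists (size s0).
have maxP i : P i -> i <= size v by case/andP => _; lia.
case: (ex_maxnP exP maxP) => i /andP [/prefixP [t Et] lt] imax.
have iv : i <= size v by lia.
case: t Et => [|x t] Et.
  by have := congr1 size (cat_take_drop i v); rewrite Et cats0 size_cat size_takel //; lia.
exists (take i v), x, t; rewrite cat_rcons -Et cat_take_drop; split=> // s' x' t'.
by move=> /PP /imax; rewrite size_takel.
Qed.

(* If [h] is the only special word of its length, then what follows the last
   non-final occurrence of [h] in [v] also follows an earlier occurrence of the
   same [h x], so the suffix of length [n] of [v] recurs. *)
Lemma deterministic_end v h e1 e2 n : n <= (size h).+1 -> n <= size v ->
  degree_le2 v -> h <> [::] ->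
  (forall f, size f = size h -> special v f -> f = h) ->
  special v (e1 :: h) -> special v (e2 :: h) -> e1 <> e2 ->
  exists c, infix (rcons (drop (size v - n) v) c) v.
Proof.
move=> nh nv deg h0 huniq sp1 sp2 ne.
have [c0 [_ [_ hc0 _]]] := special_consl sp1.
have [s [x [t [Ev smax]]]] := last_occurrence hc0.
(* The last letter of [h] has at most two successors, one of them [x]; the two letters that follow
   [e :: h] exhaust them. *)
have ext e : special v (e :: h) -> infix (e :: rcons h x) v.
  case=> c [d [cd ec ed]].
  case/lastP: h h0 {huniq nh sp1 sp2 hc0 smax} => [//|h y] h0 in Ev ec ed *.
  have tail b : infix (rcons (e :: rcons h y) b) v -> infix [:: y; b] v.
    by rewrite -!cats1 -cat_cons -catA => /catl_infix.
  have yx : infix [:: y; x] v.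
    by rewrite Ev -2!cats1 -!catA; do 2!apply: infix_catl; exact: prefix_infix.
  by case/or3P: (deg _ _ _ _ yx (tail _ ec) (tail _ ed)) => /eqP; [move=> ->|move=> ->|].
(* Preceded by different letters, [h x] occurs at two positions, so at least one lies before
   [size s]. *)
have [s2 [t2 [E2 lt2]]] : exists s2 t2, v = s2 ++ rcons h x ++ t2 /\ size s2 < size s.
  case/infixP: (ext _ sp1) => a1 [b1 E1]; case/infixP: (ext _ sp2) => a2 [b2 E2].
  have F1 : v = rcons a1 e1 ++ rcons h x ++ b1 by rewrite E1 cat_rcons.
  have F2 : v = rcons a2 e2 ++ rcons h x ++ b2 by rewrite E2 cat_rcons.
  have := smax _ _ _ F1; rewrite leq_eqVlt => /orP [/eqP G1|]; last by exists (rcons a1 e1), b1.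
  have := smax _ _ _ F2; rewrite leq_eqVlt => /orP [/eqP G2|]; last by exists (rcons a2 e2), b2.
  case: ne; have := congr1 (take (size s)) F1; rewrite {1}F2 -{1}G2 -G1 !take_size_cat //.
  by case/rcons_inj.
have lt_t : size t < size t2.
  by have := congr1 size Ev; rewrite {1}E2 !size_cat; lia.
case: (prefix_or_split (ltnW lt_t)) => [/prefixP [[|c t3] Et2]|].
- by rewrite Et2 cats0 ltnn in lt_t.
- exists c; apply/infixP; rewrite {1}E2 Et2.
  have: suffix (drop (size v - n) v) (rcons h x ++ t).
    apply: suffix_common (suffix_drop _ _) _ _; first by rewrite {1}Ev suffix_suffix.
    by rewrite size_drop size_cat size_rcons; lia.
  case/suffixP=> k Ek; exists (s2 ++ k), t3.
  by rewrite [rcons (drop _ _) _ ++ _]cat_rcons (catA (rcons h x)) Ek -!catA.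
(* If the two continuations split after [r], the suffix [g] of [h x r] is special, so it equals [h]
   and occurs beyond the last occurrence of [h]. *)
case=> r [y [y' [u [u' [Et Et2 ney]]]]].
pose z := rcons h x ++ r.
pose g := drop (size z - size h) z; pose k := take (size z - size h) z.
have szg : size g = size h by rewrite size_drop /z size_cat size_rcons; lia.
have Ez : z = k ++ g by rewrite cat_take_drop.
have V1 : v = (s ++ k) ++ rcons g y ++ u.
  by rewrite Ev Et !cat_rcons -!catA -cat_rcons (catA _ r) -/z Ez -!catA.
have V2 : v = (s2 ++ k) ++ rcons g y' ++ u'.
  by rewrite E2 Et2 !cat_rcons -!catA -cat_rcons (catA _ r) -/z Ez -!catA.
have Eg : g = h.
  apply: huniq => //; exists y, y'; split=> //; first by rewrite V1 infix_infix.
  by rewrite V2 infix_infix.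
have := smax _ _ _ (etrans V1 (congr1 (fun g => _ ++ rcons g _ ++ _) Eg)).
by rewrite size_cat size_takel /z size_cat size_rcons; lia.
Qed.

(** Strong induction on the length of [h]. Counting gives uniqueness at length [(size h).+1] once
    every factor of that length extends to the right. This follows from uniqueness at length
    [size h] by [deterministic_end], or, for empty [h], from the recurrence of the last letter. *)
Theorem slow_growth_special v : slow_growth v -> head_recurs (rev v) ->
  degree_le2 v /\ special_chain v.
Proof.
move=> sg hr; have ext1 := head_recurs_extends hr.
have deg : degree_le2 v.
  by move=> x c1 c2 c3; apply: (special_degree (sg 1 isT) ext1 (f := [:: x])).
split=> // h; have [m] := ubnP (size h); elim: m h => // m IH h; rewrite ltnS => lm.
move=> e1 e2 sp1 sp2; apply/eqP/negPn/negP => /eqP ne.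
pose n := (size h).+1.
have nv : n <= size v.
  by case: (sp1) => c [d [_ /size_infix]]; rewrite size_rcons => /ltnW.
suff [c tc] : exists c, infix (rcons (drop (size v - n) v) c) v.
  have extn := suffix_extends nv tc.
  case: ne; suff [] : e1 :: h = e2 :: h by [].
  by apply: (special_inj (sg n isT) extn).
have tv : infix (drop (size v - n) v) v by apply: infix_drop.
case: (eqVneq h [::]) => [h0|/eqP h0].
  by apply: ext1 tv _; rewrite size_drop subKn // /n h0.
apply: (deterministic_end _ nv deg h0 _ sp1 sp2 ne) => // f sf spf.
apply: (special_chain_inj (m := size h)) (special_consl sp1) => //; last by rewrite sf.
by move=> h' e e' lt; apply: IH; apply: leq_trans lm.
Qed.

End SpecialFactors.

(** * Words with a hub *)

Section Filling.
Variables (T : eqType) (a : T).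
Implicit Types (x y b c d e : T) (u v w p q s t f g h r z : seq T).

Definition hub v := sorted (fun x y => (x == a) || (y == a)) v.

(** The elementary episturmian morphism that fixes [a] and sends any other letter [x] to [x a]. *)
Definition fill g := flatten [seq if x == a then [:: a] else [:: x; a] | x <- g].

Lemma fill_cat s t : fill (s ++ t) = fill s ++ fill t.
Proof. by rewrite /fill map_cat flatten_cat. Qed.

Lemma fill_cons x g : fill (x :: g) = x :: (if x == a then fill g else a :: fill g).
Proof. by rewrite /fill /=; case: eqP => [->|]. Qed.

Lemma fill_rcons g x : fill (rcons g x) = fill g ++ (if x == a then [:: a] else [:: x; a]).
Proof. by rewrite -cats1 fill_cat /fill /= cats0. Qed.

Lemma last_fill g : last a (fill g) = a.
Proof. by elim/last_ind: g => // g x _; rewrite fill_rcons last_cat; case: eqP. Qed.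

Lemma fill_nonempty g : g <> [::] -> exists u, fill g = rcons u a.
Proof.
case/lastP: g => // g x _; rewrite fill_rcons; case: eqP => _.
  by exists (fill g); rewrite cats1.
by exists (rcons (fill g) x); rewrite -!cats1 -catA.
Qed.

Lemma fill_eq1 p : fill p = [:: a] -> p = [:: a].
Proof.
case: p => // y p; rewrite fill_cons; case: eqP => [-> []|_ []] //.
by case: p => // z p; rewrite fill_cons.
Qed.

Lemma size_fill g : size (fill g) = size g + count (predC1 a) g.
Proof. by elim: g => // x g IH; rewrite fill_cons /=; case: eqP => _ /=; lia. Qed.

Lemma rev_fill g : rev (a :: fill g) = a :: fill (rev g).
Proof.
elim: g => // x g IH; rewrite (rev_cons x) fill_rcons -cat_cons -IH fill_cons.
by case: eqP => [->|ne]; rewrite !rev_cons -!cats1 -!catA.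
Qed.

Lemma palindrome_fill g : palindrome g -> palindrome (a :: fill g).
Proof. by move=> /eqP pg; rewrite /palindrome rev_fill pg. Qed.

Lemma hub_cat u x y v : hub (u ++ x :: y :: v) -> x = a \/ y = a.
Proof.
move=> H; have: infix [:: x; y] (u ++ x :: y :: v) by rewrite infix_catl //= !eqxx prefix0s.
by move/infix_sorted => /(_ _ H) /=; rewrite andbT => /orP [] /eqP; auto.
Qed.

Lemma hub_fill g : hub (a :: fill g).
Proof.
by elim: g => //= x g IH; rewrite fill_cons; case: eqP => [->|ne] //=; rewrite ?eqxx ?orbT.
Qed.

Lemma prefix_fill p g : prefix (fill p) (fill g) -> prefix p g.
Proof.
elim: p g => [|x p IH] [|y g]; rewrite ?prefix0s //; first by rewrite fill_cons.
rewrite !fill_cons /= => /andP [/eqP <-]; rewrite eqxx /=.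
by case: ifP => _; rewrite /= ?eqxx /=; apply: IH.
Qed.

(** Every block of [fill] ends in [a], so a new block begins right after the leading [a] of an
    occurrence, which can then be decoded. *)
Lemma infix_fill p g : infix (a :: fill p) (a :: fill g) -> infix p g.
Proof.
elim: g => [|x g IH].
  by case: p => [|y p]; [rewrite infix0s|rewrite fill_cons => /size_infix /=; case: ifP].
rewrite infix_consl => /orP [|].
  by rewrite /= eqxx /= => /prefix_fill H; rewrite -infix_consl prefixW.
rewrite fill_cons; case: eqP => [->|ne].
  by move/IH => H; rewrite infix_consl H orbT.
rewrite infix_consl => /orP [|]; first by case/andP => /eqP E; case: ne.
by move/IH => H; rewrite infix_consl H orbT.
Qed.

(** Induction on the last letter [x]. The palindrome [p] that it creates in [g] yields the new
    palindrome [a :: fill p]. If [x <> a], two letters are appended, and the first creates this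
    palindrome stripped of its outer letters [a]. *)
Lemma rich_fill g : rich g -> rich (a :: fill g).
Proof.
elim/last_ind: g => [|g x IH]; first by move=> _; exact: (rich_uniq (s := [:: a])).
case/rich_rcons => /IH rg [p /and3P [sp pp np]].
have nEp : ~~ infix (a :: fill p) (a :: fill g) by apply: contra np; apply: infix_fill.
have p0 : p <> [::] by move=> E; rewrite E infix0s in np.
have sEp : suffix (a :: fill p) (a :: fill (rcons g x)).
  case/suffixP: sp => s ->; rewrite fill_cat -cat_cons.
  case/lastP: {np nEp rg IH} s => [|s y]; first by rewrite suffix_refl.
  have [|u ->] := @fill_nonempty (rcons s y); first by case: s.
  by rewrite -rcons_cons cat_rcons suffix_suffix.
have pEp := palindrome_fill pp.
rewrite fill_rcons in sEp *; case: eqP => [Ex|nx] in sEp *.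
  rewrite cats1 -rcons_cons; apply/rich_rcons; split=> //.
  by exists (a :: fill p); apply/and3P; split=> //; rewrite rcons_cons -cats1.
have [u Eu] := fill_nonempty p0.
have pu : palindrome u.
  move: pEp; rewrite /palindrome Eu rev_cons rev_rcons /= => /eqP [/eqP].
  by rewrite eqseq_rcons => /andP [].
have su : suffix u (rcons (a :: fill g) x).
  have: suffix (rcons (a :: u) a) (rcons (rcons (a :: fill g) x) a).
    have -> : rcons (rcons (a :: fill g) x) a = a :: fill g ++ [:: x; a].
      by rewrite -!cats1 -catA.
    by rewrite rcons_cons -Eu.
  by rewrite suffix_rcons => /andP [_]; apply: (catl_suffix (s := [:: a])).
have [u0 Eu0] : exists u0, u = rcons u0 x.
  case/lastP: u => [|u y] in Eu su pu *.
    by move: sp; rewrite (fill_eq1 Eu) -[[:: a]]/(rcons [::] a) suffix_rcons => /andP [/eqP /esym].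
  by move: su; rewrite suffix_rcons => /andP [/eqP -> _]; exists u.
(* As [u] begins and ends with [x <> a], any occurrence of it is flanked by the hub on both sides
   and becomes one of [a :: fill p]. *)
have nu : ~~ infix u (a :: fill g).
  apply: contra nEp => /infixP [s [t E]]; rewrite Eu.
  have hd : exists t', u = x :: t'.
    by move/eqP: pu; rewrite Eu0 rev_rcons => <-; exists (rev u0).
  case: hd => t' Et'.
  have [s' Es'] : exists s', s = rcons s' a.
    case/lastP: s => [|s y] in E *; first by case: E; rewrite Et' => -[] /esym.
    exists s; congr rcons; have := hub_fill g.
    by rewrite E Et' cat_rcons => /hub_cat [].
  have [t'' Et''] : exists t'', t = a :: t''.
    case: t => [|y t] in E *.
      have := last_fill g; rewrite -[last a _]/(last a (a :: fill g)) E cats0 Eu0.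
      by rewrite last_cat last_rcons => /nx.
    exists t; congr cons; have := hub_fill g.
    by rewrite E Eu0 -cats1 -catA catA => /hub_cat [].
  by apply/infixP; exists s', t''; rewrite E Es' Et'' cat_rcons cat_cons cat_rcons.
have -> : a :: fill g ++ [:: x; a] = rcons (rcons (a :: fill g) x) a.
  by rewrite -!cats1 -catA.
apply/rich_rcons; split.
  by apply/rich_rcons; split=> //; exists u; apply/and3P.
exists (a :: fill p); apply/and3P; split=> //; first by rewrite -!cats1 -catA.
rewrite infix_rconsl negb_or nEp andbT Eu -rcons_cons suffix_rcons.
by apply/negP => /andP [/eqP /esym].
Qed.

Lemma hub_rcons v : hub v -> hub (rcons v a).
Proof. by case: v => //= x v; rewrite rcons_path => -> /=; rewrite eqxx orbT. Qed.

Lemma hub_cons v : hub v -> hub (a :: v).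
Proof. by case: v => //= x v ->; rewrite eqxx. Qed.

Lemma hub_decode t : hub (a :: t) -> last a t = a -> exists g, t = fill g.
Proof.
have [n] := ubnP (size t); elim: n t => // n IH [|x t] sz H L; first by exists [::].
have Ht : hub (x :: t) by case/andP: H.
case: (eqVneq x a) => [Ex|nx].
  have [|||g ->] := IH t; [exact: sz|by rewrite -Ex|by rewrite /= Ex in L|].
  by exists (a :: g); rewrite Ex fill_cons eqxx.
case: t => [|y t] in sz H L Ht *; first by case/eqP: nx.
have Ey : y = a by case/andP: Ht; rewrite (negPf nx) => /eqP.
have [|||g Eg] := IH t; first by move: sz => /=; lia.
- by move: Ht; rewrite Ey => /andP [].
- by move: L; rewrite /= Ey.
by exists (x :: g); rewrite fill_cons (negPf nx) Ey Eg.
Qed.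

(* [v] is [a :: fill g] with its first and last letters [a] cut off as needed for
   [v] to begin and end with the letters it does. *)
Definition filled v g :=
  nseq (head a v != a) a ++ v ++ nseq (last a v != a) a = a :: fill g.

Lemma filled_exists v : v <> [::] -> hub v -> exists g, filled v g.
Proof.
move=> v0 hv; pose w := v ++ nseq (last a v != a) a.
have hw : hub w /\ last a w = a.
  rewrite /w; case: eqP => [E|ne]; first by rewrite cats0.
  by rewrite cats1 last_rcons hub_rcons.
have hd : head a v = head a w by rewrite /w; case: (v) v0.
have w0 : w <> [::] by rewrite /w; case: (v) v0.
case: hw; rewrite /filled -/w {}hd; case: w w0 => // x t _ hw L.
case: (eqVneq x a) => [Ex|nx] /=.
  by rewrite Ex in hw L *; have [g ->] := hub_decode hw L; exists g.
have [||g ->] := @hub_decode (x :: t); last by exists g.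
  exact: hub_cons.
by [].
Qed.

Lemma filled_infix v g : filled v g -> infix v (a :: fill g).
Proof. by move=> <-; apply: infix_infix. Qed.

Lemma filled_rev v g : v <> [::] -> filled v g -> filled (rev v) (rev g).
Proof.
move=> v0 F; rewrite /filled -rev_fill -F !rev_cat !rev_nseq -catA.
have H s : head a (rev s) = last a s.
  by case/lastP: s => // s y; rewrite rev_rcons last_rcons.
by rewrite H -[last a (rev v)]H revK.
Qed.

(* The two letters cut off in [filled] are harmless: an occurrence in [g]
   leaves a letter [a] before it unless it is a prefix of [g], and then
   [e <> a] if the first letter has been cut off. *)
Lemma filled_factor v g e h c : filled v g ->
  infix (e :: rcons h c) g -> infix (e :: rcons (a :: fill h) c) v.
Proof.
move=> F /infixP [s [t Eg]].
have [s' Es] : exists s', a :: fill s = rcons s' a.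
  case: (s) => [|y s0]; first by exists [::].
  by have [//|u ->] := @fill_nonempty (y :: s0); exists (a :: u); rewrite rcons_cons.
have [s2 Ee] : exists s2, a :: fill (rcons s e) = s2 ++ [:: e; a].
  rewrite fill_rcons -cat_cons Es; case: eqP => [->|_].
    by exists s'; rewrite cat_rcons.
  by exists (rcons s' a).
have [t2 Et] : exists t2, fill (c :: t) = c :: t2 by rewrite fill_cons; eexists.
have E : a :: fill g = s2 ++ (e :: rcons (a :: fill h) c) ++ t2.
  have -> : g = rcons s e ++ h ++ c :: t by rewrite Eg cat_cons !cat_rcons.
  by rewrite 2!fill_cat -cat_cons Ee Et -catA /= cat_rcons.
have [s3 F1] : exists s3, v ++ nseq (last a v != a) a = s3 ++ (e :: rcons (a :: fill h) c) ++ t2.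
  move: (F); rewrite /filled; case: eqP => [_|hd] /=; first by rewrite E => ->; exists s2.
  case: s2 Ee E => [|y s2] Ee E; last by rewrite E => -[_ ->]; exists s2.
  case: Ee => Ea; rewrite fill_rcons -Ea eqxx; case: (s) Eg => [|y s0] Eg; last first.
    by rewrite fill_cons; case: ifP; case: fill.
  move: F; rewrite /filled (introF eqP hd) Eg -Ea /= fill_cons eqxx => F; case: hd.
  by case: (v) F => //= x v0 [->].
move: F1; case: eqP => [_|la]; rewrite [nseq _ _]/=.
  by rewrite cats0 => ->; apply: infix_infix.
case/lastP: t2 Et {E} => [|t2 y] Et.
  rewrite cats0 cats1 -/(rcons (e :: a :: fill h) c) -rcons_cat.
  case/rcons_inj => Ev _.
  by case: la; rewrite Ev last_cat /= last_fill.
by rewrite cats1 -2!rcons_cat => /rcons_inj [-> _]; apply: infix_infix.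
Qed.

(** A special [e :: h] of [g] becomes the special [e :: a :: fill h] of [v], as filling keeps the
    letter that follows. *)
Lemma filled_special_chain v g : filled v g -> special_chain v -> special_chain g.
Proof.
move=> F ch h e1 e2.
have tr e : special g (e :: h) -> special v (e :: a :: fill h).
  by move=> [c [d [cd /(filled_factor F) ec /(filled_factor F) ed]]]; exists c, d.
by move=> /tr s1 /tr; apply: ch.
Qed.

Lemma filled_rich v g : filled v g -> rich g -> rich v.
Proof. by move=> F /rich_fill; apply: rich_infix (filled_infix F). Qed.

End Filling.

(** * Palindromic prefixes and suffixes that jointly cover a word *)

Section Covers.
Variable T : eqType.
Implicit Types (a x y : T) (u v w p q s t f g h r z : seq T).

(** Used with [n] equal to [size v] or one of its neighbours: a gap of at most one letter, no gap,
    an overlap. *)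
Definition covers v n := exists p q,
  [/\ prefix p v, suffix q v, palindrome p /\ palindrome q & n <= size p + size q].

Lemma covers_rev v n : covers v n -> covers (rev v) n.
Proof.
move=> [p [q [pv qv [pp pq] le]]]; exists (rev q), (rev p).
by rewrite prefix_rev suffix_rev !palindrome_rev !size_rev addnC.
Qed.

Lemma covers_le v m n : m <= n -> covers v n -> covers v m.
Proof. by move=> le [p [q [? ? ? le2]]]; exists p, q; split=> //; apply: leq_trans le2. Qed.

Lemma palindrome1 x : palindrome [:: x].
Proof. by rewrite /palindrome /rev /= eqxx. Qed.

Lemma covers_nonempty v n : v <> [::] -> covers v n -> exists p q,
  [/\ prefix p v /\ p <> [::], suffix q v /\ q <> [::], palindrome p /\ palindrome q
    & n <= size p + size q].
Proof.
move=> v0 [p [q [pv qv [pp pq] le]]].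
have [p' [p'v [p'0 pp'] lep]] :
    exists p', [/\ prefix p' v, p' <> [::] /\ palindrome p' & size p <= size p'].
  case: p pv pp le => [|x p] pv pp le; last by exists (x :: p).
  by case: v v0 pv {qv} => // x v _ _; exists [:: x]; rewrite palindrome1 /= eqxx prefix0s.
have [q' [q'v [q'0 pq'] leq]] :
    exists q', [/\ suffix q' v, q' <> [::] /\ palindrome q' & size q <= size q'].
  case: q qv pq le => [|x q] qv pq le; last by exists (x :: q).
  case/lastP: v v0 qv {pv p'v} => // v x _ _; exists [:: x].
  by rewrite palindrome1 -cats1 suffix_suffix.
by exists p', q'; split=> //; lia.
Qed.

Variable a : T.

(** Filling adds a letter for each letter other than [a]. The part of [g] after [p] is a suffix of
    [q]. If [k] holds, [q] is longer, and its first letter, by symmetry the last letter of [g],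
    differs from [a]: the overlap is worth two letters after filling. *)
Lemma size_fill_cover g p q (k : bool) : prefix p g -> suffix q g -> palindrome q ->
  size g + k <= size p + size q -> (k -> last a g != a) ->
  (size (a :: fill a g) + k.*2).+1 <= size (a :: fill a p) + size (a :: fill a q).
Proof.
case/prefixP=> s Es sq /eqP pq le lk /=; rewrite !size_fill.
suff : count (predC1 a) g + k <= count (predC1 a) p + count (predC1 a) q by lia.
have {}le : size s + k <= size q by move: le; rewrite Es size_cat; lia.
have /suffixP [d Ed] : suffix s q.
  by apply: (@suffix_common _ _ _ g) => //; [rewrite Es suffix_suffix|lia].
rewrite Es count_cat -addnA leq_add2l Ed count_cat addnC leq_add2r.
case: k lk le => //= /(_ isT) lg; rewrite Ed size_cat => le.
case: d => [|x d] in Ed le *; first by move: le => /=; lia.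
suff -> : x = last a g by rewrite /= lg.
by have /suffixP [r ->] := sq;  rewrite last_cat -pq Ed /= rev_cons last_rcons.
Qed.

Lemma fill_core p : p <> [::] -> palindrome p ->
  exists2 u, a :: fill a p = a :: rcons u a & palindrome u.
Proof.
move=> p0 pp; have [u Eu] := fill_nonempty a p0; exists u; first by rewrite Eu.
have := palindrome_fill a pp; rewrite /palindrome Eu rev_cons rev_rcons /= => /eqP [/eqP].
by rewrite eqseq_rcons => /andP [].
Qed.

Lemma fill_prefix p g : prefix p g -> prefix (a :: fill a p) (a :: fill a g).
Proof. by case/prefixP=> s ->; rewrite fill_cat -cat_cons prefix_prefix. Qed.

Lemma fill_suffix p g : suffix p g -> suffix (a :: fill a p) (a :: fill a g).
Proof. by rewrite -!prefix_rev !rev_fill; apply: fill_prefix. Qed.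

Lemma prefix_core u v : prefix (a :: rcons u a) (a :: rcons v a) -> prefix u v.
Proof.
rewrite /= eqxx /= => /prefixP [s]; case/lastP: s => [|s y].
  by rewrite cats0 => /rcons_inj [->]; apply: prefix_refl.
by rewrite -rcons_cat cat_rcons => /rcons_inj [-> _]; apply: prefix_prefix.
Qed.

Lemma suffix_core u v : suffix (a :: rcons u a) (a :: rcons v a) -> suffix u v.
Proof. by rewrite /suffix !rev_cons !rev_rcons; apply: prefix_core. Qed.

Lemma covers_uncut g : covers g (size g) -> covers (a :: fill a g) (size (a :: fill a g)).+1.
Proof.
move=> [p [q [pg qg [pp pq] le]]]; exists (a :: fill a p), (a :: fill a q); split.
- exact: fill_prefix.
- exact: fill_suffix.
- by split; apply: palindrome_fill.
- by have := size_fill_cover (k := false) pg qg pq; rewrite !addn0; apply.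
Qed.

(** The two filled palindromes lose four outer letters [a] in all, while the word loses two. *)
Lemma covers_cut2 v g (k : bool) : g <> [::] -> a :: rcons v a = a :: fill a g ->
  (k -> last a g != a) -> covers g (size g + k) -> covers v (size v + k.*2).-1.
Proof.
move=> g0 E lk /(covers_nonempty g0) [p [q [[pg p0] [qg q0] [pp pq] le]]].
have [u Eu pu] := fill_core p0 pp; have [u' Eu' pu'] := fill_core q0 pq.
exists u, u'; split=> //.
- by apply: prefix_core; rewrite -Eu E; apply: fill_prefix.
- by apply: suffix_core; rewrite -Eu' E; apply: fill_suffix.
have := size_fill_cover pg qg pq le lk; rewrite -E Eu Eu' /= !size_rcons; lia.
Qed.

Lemma covers_cut1 v g : g <> [::] -> rcons v a = a :: fill a g ->
  covers g (size g) -> covers v (size v).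
Proof.
move=> g0 E /(covers_nonempty g0) [p [q [[pg p0] [qg q0] [pp pq] le]]].
(* If [p] is all of [g], then [a :: fill a p] is longer than [v]. But [g] is then a palindrome and
   can serve as [q]; the letter [a] followed by the core of [a :: fill a g] is all of [v]. *)
wlog ltp : p q pg p0 qg q0 pp pq le / size p < size g \/ q = g.
  move=> H; case: (ltnP (size p) (size g)) => [lt|ge]; first by apply: (H p q) => //; left.
  have Ep : p = g.
    by case/prefixP: pg ge => [[|x s]] ->; rewrite ?cats0 // size_cat /=; lia.
  by subst p; apply: (H g g); rewrite ?suffix_refl ?leq_addr //; right.
have [u Eu pu] := fill_core q0 pq.
have su : suffix (a :: u) v.
  have := fill_suffix qg; rewrite -E Eu => /suffixP [s].
  by rewrite -rcons_cons -rcons_cat => /rcons_inj [->]; apply: suffix_suffix.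
have {}su := suffix_trans (suffix_cons _ _) su.
case: ltp => [ltp|Eq].
  exists (a :: fill a p), u; split=> //.
  - have := fill_prefix pg; rewrite -E => /prefixP [s]; case/lastP: s => [|s y].
      rewrite cats0 E => -[/(congr1 size)]; case/prefixP: pg ltp => s ->.
      by rewrite fill_cat !size_cat; case: s => [|x s]; rewrite ?fill_cons /=; lia.
    by rewrite -rcons_cat => /rcons_inj [-> _]; apply: prefix_prefix.
  - by split=> //; apply: palindrome_fill.
  have := size_fill_cover (k := false) pg qg pq;
    rewrite !addn0 => /(_ le (fun k => False_ind _ (notF k))).
  by rewrite -E Eu /= !size_rcons; lia.
exists [:: a], u; split=> //.
  case: v E su => [[/esym]|x v [-> _] _]; last by rewrite /= eqxx prefix0s.
  by have [w ->] := fill_nonempty a g0; case: w.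
  by split=> //; apply: palindrome1.
have /= := congr1 size E; rewrite -Eq; have /= -> := congr1 size Eu.
by rewrite !size_rcons; lia.
Qed.

(** The cover exceeds [size v] by 1, 0 or -1 when no, one or two end letters are cut off; an overlap
    in [g] raises the last value to 1. *)
Lemma filled_covers v g : filled a v g -> v <> [::] -> covers g (size g) ->
  [/\ head a v = a \/ last a v = a -> covers v (size v),
      covers v (size v).-1,
      head a v = last a v -> head a v = a -> covers v (size v).+1 &
      head a v = last a v -> covers g (size g).+1 -> covers v (size v).+1].
Proof.
move=> F v0 cg.
have g0 : head a v <> a \/ last a v <> a -> g <> [::].
  move=> ne Eg; move: F; rewrite /filled Eg /=; case: v v0 ne {cg} => // x v _ /= ne.
  case: eqP => [Ex|nx] //=.
  by subst x; case: v ne => [|y v] [] //.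
case: (eqVneq (head a v) a) (F) => [hd|/eqP hd]; case: (eqVneq (last a v) a) => [la|/eqP la];
  rewrite /filled ?hd ?la ?(introF eqP hd) ?(introF eqP la) ?eqxx /= ?cats0 => E.
- have c1 : covers v (size v).+1 by rewrite E; apply: covers_uncut.
  by split=> *; apply: covers_le c1; lia.
- have c1 : covers v (size v).
    by apply: (@covers_cut1 v g) => //; [apply: g0; right|rewrite -cats1].
  split=> //; first by apply: covers_le c1; lia.
  + by move=> Eh; case: la; rewrite -Eh.
  + by move=> Eh; case: la; rewrite -Eh.
- have c1 : covers v (size v).
    rewrite -[v]revK size_rev; apply/covers_rev/(@covers_cut1 _ (rev g)).
    + by move/(congr1 rev); rewrite revK => /g0; apply; left.
    + by rewrite -rev_cons E rev_fill.
    + by rewrite size_rev; apply: covers_rev.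
  split=> [_|||]; [exact: c1| |by move/hd|by move/hd].
  by apply: covers_le c1; lia.
have {}g0 : g <> [::] by apply: g0; left.
have E' : a :: rcons v a = a :: fill a g by rewrite -cats1.
split=> [[] //||_ /hd|Eh c1] //.
  by have := covers_cut2 (k := false) g0 E'; rewrite !addn0; apply.
have := covers_cut2 (k := true) g0 E'; rewrite addn1 addn2 /=; apply=> // _.
apply/eqP => lg; apply: la.
have [g' Eg] : exists g', g = rcons g' a.
  by case/lastP: (g) g0 lg => // g' y _; rewrite last_rcons => ->; exists g'.
move: E'; rewrite Eg fill_rcons eqxx cats1 => -[/rcons_inj [->]].
by rewrite last_fill.
Qed.
End Covers.

(** * Binary words *)

Section Binary.
Variable T : eqType.
Implicit Types (a b c x y : T) (u v w p q s t f g h r z : seq T).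

Lemma count_fill a g : count (predC1 a) (fill a g) = count (predC1 a) g.
Proof. by elim: g => // x g IH; rewrite fill_cons /=; case: eqP => _ /=; rewrite ?eqxx /= IH. Qed.

(** Each cut is charged to an end letter of [v] other than [a]; [1 < size v] makes the two ends
    distinct positions. *)
Lemma filled_size a v g : filled a v g -> 1 < size v -> size g < size v.
Proof.
move=> F sv; have := congr1 size F; have := congr1 (count (predC1 a)) F.
rewrite /= count_fill size_fill !count_cat !count_nseq !size_cat !size_nseq /= eqxx !add0n addn0.
suff : (head a v != a) + (last a v != a) <= count (predC1 a) v by lia.
case: v sv {F} => // x v; case/lastP: v => // v y _.
by rewrite /= last_rcons -cats1 count_cat /= !addn0; lia.
Qed.

Lemma filled_letters a v g : filled a v g -> {subset g <= a :: v}.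
Proof.
move=> F x xg; have : x \in a :: fill a g.
  elim: g xg {F} => // y g IH; rewrite inE fill_cons => /orP [/eqP ->|/IH].
    by rewrite !inE eqxx orbT.
  by case: ifP => _; rewrite !inE => /orP [] ->; rewrite ?orbT.
rewrite -F !mem_cat !mem_nseq !inE.
by case/or3P => [/andP [_ ->]|->|/andP [_ ->]]; rewrite ?orbT.
Qed.

Lemma not_hub a v : ~~ hub a v -> exists x y, [/\ infix [:: x; y] v, x <> a & y <> a].
Proof.
rewrite /hub; elim: v => //= x [|y v] IH //=.
rewrite negb_and negb_or => /orP [/andP [/eqP nx /eqP ny]|/IH [c [d [cd nc nd]]]].
  by exists x, y; rewrite !eqxx prefix0s.
by exists c, d; split=> //; apply: infix_trans cd (infix_cons _ _).
Qed.

Lemma hubI a v : (forall x y, infix [:: x; y] v -> x = a \/ y = a) -> hub a v.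
Proof. by move=> H; apply/negPn/negP => /not_hub [x [y [/H [] ]]]. Qed.

Lemma hubE a v x y : hub a v -> infix [:: x; y] v -> x = a \/ y = a.
Proof. by move=> hv /infixP [s [t E]]; apply: (@hub_cat _ a s x y t); rewrite -E. Qed.

Lemma two_blocks a b v : {subset v <= [:: a; b]} -> ~~ infix [:: b; a] v ->
  exists k l, v = nseq k a ++ nseq l b.
Proof.
elim: v => [|x v IH] sub nba; first by exists 0, 0.
have [||k [l E]] := IH.
- by move=> y yv; apply: sub; rewrite inE yv orbT.
- by apply: contra nba => H; rewrite infix_consl H orbT.
have := sub x (mem_head _ _); rewrite !inE => /orP [] /eqP Ex.
  by exists k.+1, l; rewrite E Ex.
case: k E => [|k] E; first by exists 0, l.+1; rewrite E Ex.
by move: nba; rewrite E Ex /= !eqxx prefix0s.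
Qed.

Lemma special_letter v x c d : c <> d -> infix [:: x; c] v -> infix [:: x; d] v -> special v [:: x].
Proof. by move=> cd xc xd; exists c, d. Qed.

(** Without a hub, both [aa] and [bb] occur. If [ab] and [ba] occurred too, both letters would be
    special. *)
Lemma binary_not_hub a b v : {subset v <= [:: a; b]} -> special_chain v ->
  ~~ hub a v -> ~~ hub b v ->
  exists x y k l, [/\ x <> y, 0 < k, 0 < l & v = nseq k x ++ nseq l y].
Proof.
move=> sub ch /not_hub [c [d [cd nc nd]]] /not_hub [c' [d' [cd' nc' nd']]].
have in2 x y : infix [:: x; y] v -> (x = a \/ x = b) /\ (y = a \/ y = b).
  move/mem_infix => xy.
  have in1 e : e \in [:: x; y] -> e = a \/ e = b.
    by move/xy/sub; rewrite !inE => /orP [] /eqP; auto.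
  by split; apply: in1; rewrite !inE eqxx ?orbT.
have bb : infix [:: b; b] v by case: (in2 _ _ cd) (cd) => [] [] // -> [] // ->.
have aa : infix [:: a; a] v by case: (in2 _ _ cd') (cd') => [] [] // -> [] // ->.
have ab : a <> b by move=> E; case: (in2 _ _ cd) => [] [] // Ec; case: nc; rewrite E.
have pos k l x y : v = nseq k x ++ nseq l y ->
    (x = a /\ y = b) \/ (x = b /\ y = a) -> 0 < k /\ 0 < l.
  move=> E xy; have av : a \in v by apply: (mem_infix aa); rewrite mem_head.
  have bv : b \in v by apply: (mem_infix bb); rewrite mem_head.
  by move: av bv; rewrite E !mem_cat !mem_nseq; case: xy => [] [-> ->];
     rewrite ?eqxx !andbT (introF eqP ab) (introF eqP (nesym ab)) ?andbF ?orbF.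
case: (boolP (infix [:: b; a] v)) => [ba|nba].
  case: (boolP (infix [:: a; b] v)) => [ab'|nab].
    case: (ab); apply: (ch [::]).
      exact: special_letter ab aa ab'.
    exact: special_letter (nesym ab) bb ba.
  have [|k [l E]] := two_blocks _ nab; first by move=> x /sub; rewrite !inE orbC.
  have [|k0 l0] := pos _ _ _ _ E; first by auto.
  by exists b, a, k, l; split=> //; apply: nesym.
have [k [l E]] := two_blocks sub nba.
have [|k0 l0] := pos _ _ _ _ E; first by auto.
by exists a, b, k, l.
Qed.

Lemma palindrome_nseq k x : palindrome (nseq k x).
Proof. by rewrite /palindrome rev_nseq. Qed.

Lemma blocks_rich x y k l : x <> y -> rich (nseq k x ++ nseq l y).
Proof.
move=> xy; apply: rich_cat; try exact: rich_nseq.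
by move=> z; rewrite !mem_nseq => /andP [_ /eqP ->]; rewrite (introF eqP xy) andbF.
Qed.

Lemma blocks_covers x y k l : covers (nseq k x ++ nseq l y) (size (nseq k x ++ nseq l y)).
Proof.
by exists (nseq k x), (nseq l y);
   rewrite prefix_prefix suffix_suffix !palindrome_nseq size_cat.
Qed.

Lemma filled_binary a b (h : T) v g : {subset v <= [:: a; b]} -> (h = a \/ h = b) ->
  filled h v g -> {subset g <= [:: a; b]}.
Proof.
move=> sub hab /filled_letters sg x /sg; rewrite inE => /orP [/eqP ->|/sub //].
by rewrite !inE; case: hab => ->; rewrite eqxx ?orbT.
Qed.

Lemma filled_head a v g : filled a v g -> head a v <> a -> head a g = head a v.
Proof.
rewrite /filled => + /eqP nh; rewrite nh; case: v nh => [|x v] /=; first by rewrite eqxx.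
by move=> _ [E]; case: g E => // y g; rewrite fill_cons => -[->].
Qed.

Lemma filled_last a v g : filled a v g -> last a v <> a -> last a g = last a v.
Proof.
move=> F nl; have v0 : v <> [::] by move=> E; rewrite E in nl.
have hr s : head a (rev s) = last a s.
  by case/lastP: s => // s y; rewrite rev_rcons last_rcons.
by have := filled_head (filled_rev v0 F); rewrite !hr; apply.
Qed.

(** Induction on the length: a word with a hub is decoded, and one without consists of two blocks.
    The overlap for equal ends is carried along because a word whose ends both differ from the hub
    needs an overlapping cover of [g]. *)
Theorem binary_chain a b v : {subset v <= [:: a; b]} -> special_chain v ->
  [/\ rich v, covers v (size v) &
      forall c, v <> [::] -> head c v = last c v -> covers v (size v).+1].
Proof.
have [n] := ubnP (size v); elim: n v => // n IH v; rewrite ltnS => sv sub ch.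
case: (leqP (size v) 1) => [|v1].
  case: v {sv sub ch} => [|x [|y v]] // _.
    by split=> //; exists [::], [::].
  have c2 : covers [:: x] 2 by exists [:: x], [:: x]; rewrite /= !eqxx suffix_refl palindrome1.
  by split=> //; [apply: rich_uniq|apply: covers_le c2].
have v0 : v <> [::] by case: (v) v1.
have hub_case (h : T) : h = a \/ h = b -> hub h v -> [/\ rich v, covers v (size v) &
      forall c, v <> [::] -> head c v = last c v -> covers v (size v).+1].
  move=> hab hv; have [g F] := filled_exists v0 hv.
  have [|||rg cg cg1] := IH g.
  - exact: leq_trans (filled_size F v1) sv.
  - exact: filled_binary hab F.
  - exact: filled_special_chain F ch.
  have [c1 _ c2 c3] := filled_covers F v0 cg.
  have main : head h v = last h v -> covers v (size v).+1.
    move=> E; case: (eqVneq (head h v) h) => [/c2|/eqP nh]; first exact.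
    apply: (c3 E); apply: (cg1 h); first by move=> Eg; case: (nh); rewrite -(filled_head F nh) Eg.
    by rewrite (filled_head F) // (filled_last F) // -E.
  split; first exact: filled_rich F rg.
    case: (eqVneq (head h v) h) => [hh|/eqP nh]; first by apply: c1; left.
    case: (eqVneq (last h v) h) => [lh|/eqP nl]; first by apply: c1; right.
    (* Over two letters, end letters that both differ from the hub are equal. *)
    apply: covers_le (leqnSn _) (main _).
    have hv' : head h v \in [:: a; b] by apply: sub; case: (v) v0 => //= x s _; rewrite mem_head.
    have lv' : last h v \in [:: a; b] by apply: sub; case: (v) v0 => //= x s _; rewrite mem_last.
    move: hv' lv' nh nl; rewrite !inE.
    by case: hab => <-; case/orP => /eqP ->; case/orP => /eqP -> //.
  by move=> c _ E; apply: main; case: (v) v0 E.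
case: (boolP (hub a v)) => [|na]; first by apply: hub_case; left.
case: (boolP (hub b v)) => [|nb]; first by apply: hub_case; right.
have [x [y [k [l [xy k0 l0 E]]]]] := binary_not_hub sub ch na nb.
rewrite E; split; [exact: blocks_rich|exact: blocks_covers|].
move=> c _; case: k k0 {E} => // k _; case: l l0 => // l _ /= E; case: xy.
rewrite E last_cat -[y :: _]/(nseq l.+1 y) -addn1 nseqD last_cat.
by [].
Qed.

End Binary.

(** * Words without a hub *)

Section Letters.
Variable T : eqType.
Implicit Types (a b c e x y : T) (u v w p q s t f g r : seq T).

Definition one_special v := [/\ degree_le2 v, special_chain v,
  degree_le2 (rev v) & special_chain (rev v)].

Lemma one_special_rev v : one_special v -> one_special (rev v).
Proof. by case=> *; split; rewrite ?revK. Qed.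

Lemma slow_growth_one_special v : slow_growth v -> head_recurs v ->
  head_recurs (rev v) -> one_special v.
Proof.
move=> sg hv hr; have [? ?] := slow_growth_special sg hr.
have [|? ?] := slow_growth_special (slow_growth_rev sg); last by [].
by rewrite revK.
Qed.

Lemma infix2_rev x y v : infix [:: x; y] (rev v) = infix [:: y; x] v.
Proof. by rewrite -infix_rev revK. Qed.

Lemma constant_letters (P : pred T) v x y :
  (forall y z, infix [:: y; z] v -> P y = P z) -> x \in v -> y \in v -> P x = P y.
Proof.
case: v => // c v cl; suff H e : e \in c :: v -> P e = P c by move=> /H -> /H ->.
elim: v c cl => [|d v IH] c cl; first by rewrite inE => /eqP ->.
have Pcd : P c = P d by apply: cl; rewrite /= !eqxx prefix0s.
rewrite inE => /orP [/eqP -> //|]; rewrite Pcd; apply: IH => y' z' yz.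
by apply: cl; apply: infix_trans yz (infix_cons _ _).
Qed.

Section TwoLoops.
Variables (h y z : T).
Hypothesis yz : y <> z.

(** Followed by both [y] and [z], [h] is the only special letter and has no other successor; hence
    [y] and [z] are followed by [h] only. *)
Let forward v x x' : degree_le2 v -> special_chain v ->
  infix [:: h; y] v -> infix [:: y; h] v -> infix [:: h; z] v -> infix [:: z; h] v ->
  infix [:: x; x'] v -> x \in [:: h; y; z] -> x' \in [:: h; y; z] /\ (x = h \/ x' = h).
Proof.
move=> deg ch hy yh hz zh xx xin.
have [Ex|nx] := eqVneq x h.
  subst x; split; last by left.
  by rewrite !inE; case/or3P: (deg _ _ _ _ hy hz xx) => /eqP // ->; rewrite eqxx ?orbT.
have xh : infix [:: x; h] v by move: xin nx; rewrite !inE => /or3P [] /eqP -> //; rewrite eqxx.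
have [<-|nx'] := eqVneq x' h; first by split; [rewrite !inE eqxx|right].
case/eqP: nx; apply: (ch [::]); last exact: special_letter yz hy hz.
by apply: special_letter xx xh; apply/eqP.
Qed.

(* Two loops at [h] use up all branching of the transition graph of [v]. *)
Lemma two_loops_hub v : one_special v ->
  infix [:: h; y] v -> infix [:: y; h] v -> infix [:: h; z] v -> infix [:: z; h] v ->
  hub h v.
Proof.
move=> [deg ch degr chr] hy yh hz zh.
have fwd x x' := forward (x := x) (x' := x') deg ch hy yh hz zh.
have bwd x x' : infix [:: x; x'] v -> x' \in [:: h; y; z] -> x \in [:: h; y; z].
  rewrite -infix2_rev => xx x'in.
  by have [] := forward degr chr _ _ _ _ xx x'in; rewrite ?infix2_rev.
have cl x x' : infix [:: x; x'] v -> (x \in [:: h; y; z]) = (x' \in [:: h; y; z]).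
  by move=> xx; apply/idP/idP => [/(fwd _ _ xx) []|/(bwd _ _ xx)].
have hv : h \in v by apply: (mem_infix hy); rewrite mem_head.
apply: hubI => x x' xx; have [] // := fwd _ _ xx.
have xv : x \in v by apply: (mem_infix xx); rewrite mem_head.
by rewrite (constant_letters (P := fun e => e \in [:: h; y; z]) cl xv hv) inE eqxx.
Qed.

End TwoLoops.

Definition hubless v := forall h, ~~ hub h v.

Lemma hub_rev h v : hub h (rev v) = hub h v.
Proof.
suff H u : hub h u -> hub h (rev u) by apply/idP/idP => /H; rewrite ?revK.
by move=> hu; apply: hubI => x y; rewrite infix2_rev => /(hubE hu) []; auto.
Qed.

Lemma hubless_rev v : hubless v -> hubless (rev v).
Proof. by move=> nh h; rewrite hub_rev. Qed.

Definition alternating p := forall x y z, infix [:: x; y; z] p -> x = z.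

(** A factor [x y z] of a palindrome also occurs reversed; if [x <> z], this gives two loops at [y]
    and makes it a hub. *)
Lemma hubless_palindrome v p : one_special v -> hubless v -> infix p v ->
  palindrome p -> alternating p.
Proof.
move=> os nh pv /eqP pp x y z xyz; apply/eqP/negPn/negP => /eqP xz.
have xyz' : infix [:: z; y; x] p by rewrite -infix_rev pp.
have sub u s : infix u s -> infix s p -> infix u v.
  by move=> us sp; apply: infix_trans us (infix_trans sp pv).
case/negP: (nh y); apply: (two_loops_hub xz os).
- by apply: sub xyz'; rewrite /= !eqxx orbT.
- by apply: sub xyz; rewrite /= !eqxx.
- by apply: sub xyz; rewrite /= !eqxx orbT.
- by apply: sub xyz'; rewrite /= !eqxx.
Qed.

Lemma alternating_letters x y t : alternating (x :: y :: t) -> {subset x :: y :: t <= [:: x; y]}.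
Proof.
elim: t x y => [|z t IH] x y alt //.
have Ez : x = z by apply: (alt x y z); rewrite /= !eqxx prefix0s.
subst z => e; rewrite inE => /orP [/eqP ->|/IH H]; first by rewrite mem_head.
have: e \in [:: y; x] by apply: H => c d f cdf; apply: alt (infix_trans cdf (infix_cons _ _)).
by rewrite !inE orbC.
Qed.

Lemma alternating_palindrome p h : palindrome p -> alternating p -> h \in p ->
  exists y, {subset p <= [:: h; y]} /\
    (1 < size p \/ y <> h -> infix [:: h; y] p /\ infix [:: y; h] p).
Proof.
case: p => [|x [|y t]] // pp alt.
  by rewrite inE => /eqP ->; exists x; split=> [e|[]] //; rewrite !inE => ->.
have xy : infix [:: x; y] (x :: y :: t) by rewrite /= !eqxx prefix0s.
have yx : infix [:: y; x] (x :: y :: t).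
  by rewrite -infix2_rev; move/eqP: pp => ->.
have sub := alternating_letters alt.
move=> /sub; rewrite !inE => /orP [] /eqP ->; first by exists y.
by exists x; split=> // e /sub; rewrite !inE orbC.
Qed.

(** If [p] uses [h, y] and [q] uses [h, z], three distinct letters, then two loops make [h] a hub;
    otherwise at most two letters remain. *)
Lemma shared_letter_binary v p q h : one_special v -> hubless v ->
  infix p v -> palindrome p -> infix q v -> palindrome q ->
  h \in p -> h \in q -> {subset v <= p ++ q} ->
  exists a b, {subset v <= [:: a; b]}.
Proof.
move=> os nh pv pp qv pq hp hq sub.
have [y [py Py]] := alternating_palindrome pp (hubless_palindrome os nh pv pp) hp.
have [z [qz Qz]] := alternating_palindrome pq (hubless_palindrome os nh qv pq) hq.
have sub' : {subset v <= [:: h; y; z]}.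
  move=> e /sub; rewrite mem_cat => /orP [/py|/qz]; rewrite !inE => /orP [] ->;
  by rewrite ?orbT.
case: (eqVneq y z) => [E|/eqP yz].
  by exists h, z => e /sub'; rewrite E !inE orbb.
case: (eqVneq y h) => [E|/eqP yh].
  by exists h, z => e /sub'; rewrite E !inE orbA orbb.
case: (eqVneq z h) => [E|/eqP zh].
  by exists h, y => e /sub'; rewrite E !inE orbCA orbb orbC.
have [|hy yh'] := Py; first by right.
have [|hz zh'] := Qz; first by right.
case/negP: (nh h).
by apply: (two_loops_hub yz os); apply: infix_trans; eassumption.
Qed.

(** The return [e w e] is a palindrome by richness, so it alternates; a second letter of [w] would
    be [e]. *)
Lemma hubless_return v e w : rich v -> one_special v -> hubless v ->
  infix (e :: rcons w e) v -> e \notin w -> size w <= 1.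
Proof.
move=> rv os nh ev ew; have pw := rich_return (rich_infix ev rv) ew.
have /(hubless_palindrome os nh ev) alt : palindrome (e :: rcons w e).
  by move: pw; rewrite /palindrome rev_cons rev_rcons => /eqP ->.
case: w ew {ev pw} alt => [|c [|d w]] // ew alt.
have E : e = d by apply: (alt e c d); rewrite /= !eqxx prefix0s.
by rewrite E !inE eqxx orbT in ew.
Qed.

Lemma first_split (P : pred T) s : has P s ->
  exists t x r, [/\ s = t ++ x :: r, P x & ~~ has P t].
Proof.
elim: s => //= x s IH; case: (boolP (P x)) => [Px _|nx /= /IH [t [y [r [-> Py nt]]]]].
  by exists [::], x, s.
by exists (x :: t), y, r; rewrite /= negb_or nx.
Qed.

Lemma last_split x s : x \in s -> exists t r, s = t ++ x :: r /\ x \notin r.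
Proof.
rewrite -mem_rev -has_pred1 => /first_split [t [y [r [E /eqP Ey nt]]]].
subst y; exists (rev r), (rev t); rewrite -[s]revK E rev_cat rev_cons cat_rcons mem_rev.
by rewrite -has_pred1.
Qed.

Lemma hubless_no_return v p s c t : rich v -> one_special v -> hubless v ->
  palindrome p -> 1 < size p -> v = s ++ c :: t -> prefix p s -> {subset s <= p} ->
  c \notin p -> forall e, e \in p -> e \notin c :: t.
Proof.
move=> rv os nh pp p1 Ev ps sp cp.
have pv : infix p v.
  by rewrite Ev; apply: infix_trans (prefixW ps) (prefix_infix _ _).
have alt := hubless_palindrome os nh pv pp.
suff H w e r : c :: t = w ++ e :: r -> (forall x, x \in w -> x \notin p) -> e \notin p.
  move=> e ep; apply/negP => et.
  have [|w [e' [r [E e'p /hasPn nw]]]] := @first_split (mem p) (c :: t).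
    by apply/hasP; exists e.
  by have := H w e' r E nw; rewrite [e' \in p]e'p.
move=> E wp; apply/negP => ep.
have w0 : 0 < size w by case: w E {wp} => // -[Ec _]; rewrite Ec ep in cp.
case/lastP: s => [|s l] in Ev ps sp *.
  by move: ps p1; rewrite prefixs0 => /eqP ->.
have lp : l \in p by apply: sp; rewrite mem_rcons mem_head.
have [y [py Py]] := alternating_palindrome pp alt lp.
have [|ly yl] := Py; first by left.
have yc : y <> c.
  move=> Ey; case/negP: cp; rewrite -Ey; apply: (mem_infix ly).
  by rewrite inE mem_seq1 eqxx orbT.
have lc : infix [:: l; c] v by rewrite Ev cat_rcons infix_catl //= !eqxx prefix0s.
have vE : v = rcons s l ++ w ++ e :: r by rewrite Ev E.
(* If the last letter [l] of [s] returns first, then [w] is [c] alone, and the loops of [l] with [y]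
   and [c] make it a hub. *)
case: (eqVneq e l) => [El|el].
  subst e; have lwl : infix (l :: rcons w l) v.
    by apply/infixP; exists s, r; rewrite vE cat_rcons /= cat_rcons.
  have lw : l \notin w by apply/negP => /wp; rewrite lp.
  have w1 := hubless_return rv os nh lwl lw.
  case: w E w0 w1 lwl {wp vE lw} => [|d [|? ?]] // [<- _] _ _ lwl.
  case/negP: (nh l); apply: (two_loops_hub yc os) => //; try exact: infix_trans pv.
  by apply: infix_trans lwl; rewrite /= !eqxx orbT.
(* If the other letter [y] of [p] returns first, the gap since its last occurrence in [s] contains
   both [l] and [c] and is too long. *)
have Ey : e = y by move: (py e ep); rewrite !inE (negPf el) => /eqP.
subst e; have ys : y \in rcons s l by apply: (mem_infix (prefixW ps)).
have [s1 [s2 [Es s2y]]] := last_split ys.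
have s20 : 0 < size s2.
  by case: s2 Es {s2y} => //; rewrite cats1 => /rcons_inj [_ El]; rewrite El eqxx in el.
have ywy : infix (y :: rcons (s2 ++ w) y) v.
  by apply/infixP; exists s1, r; rewrite vE Es -!catA /= cat_rcons -catA.
have yw : y \notin w by apply/negP => /wp; rewrite ep.
have := hubless_return rv os nh ywy; rewrite mem_cat negb_or s2y yw size_cat => /(_ isT) le.
by have := leq_trans (leq_add s20 w0) le.
Qed.

Definition binary v := exists a b, {subset v <= [:: a; b]}.

Lemma binary_rev v : binary (rev v) -> binary v.
Proof. by move=> [a [b sub]]; exists a, b => e; rewrite -mem_rev => /sub. Qed.

(** [s] is the longest prefix of [v] over the letters of [p]; it is not all of [v], as [p] has at
    most two letters. *)
Lemma hubless_side v p : rich v -> one_special v -> hubless v -> ~ binary v ->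
  prefix p v -> palindrome p -> 1 < size p ->
  exists s t, [/\ v = s ++ t, prefix p s, {subset s <= p}, t <> [::] &
    forall e, e \in p -> e \notin t].
Proof.
move=> rv os nh nb pv pp p1.
case: (boolP (has (predC (mem p)) v)) => [/first_split [s [c [t [E cp np]]]]|np].
  have sp : {subset s <= p}.
    by move=> e es; move/hasPn: np => /(_ e es); rewrite negbK.
  have ps : prefix p s.
    case: (leqP (size p) (size s)) => sz.
      case/prefixP: pv => d; rewrite E => /esym /cat_eq_split [] // d' -> _.
      exact: prefix_prefix.
    case/prefixP: pv => d; rewrite E => /cat_eq_split [|[|c' d'] Ep]; first exact: ltnW.
      by rewrite Ep cats0 ltnn in sz.
    by case=> Ec _; case/negP: cp; rewrite /= Ep Ec mem_cat mem_head orbT.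
  exists s, (c :: t); split=> //.
  exact: hubless_no_return rv os nh pp p1 E ps sp cp.
case: nb; case: (p) p1 pp pv np => [|h p'] // _ pp pv np.
have alt := hubless_palindrome os nh (prefixW pv) pp.
have [y [sub _]] := alternating_palindrome pp alt (mem_head _ _).
exists h, y => e ev; apply: sub.
by move/hasPn: np => /(_ e ev); rewrite negbK.
Qed.

Lemma rich_hubless v p q : rich v -> one_special v -> hubless v -> ~ binary v ->
  prefix p v -> palindrome p -> 1 < size p ->
  suffix q v -> palindrome q -> 1 < size q ->
  exists s z t, [/\ v = s ++ z ++ t, prefix p s /\ suffix q t,
    {subset s <= p} /\ {subset t <= q}, forall e, e \in p -> e \notin q &
    forall e, e \in z -> e \notin p /\ e \notin q].
Proof.
move=> rv os nh nb pv pp p1 qv pq q1.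
have [s [t' [E ps sp t'0 nt']]] := hubless_side rv os nh nb pv pp p1.
have [|||||||t [s' [E' qt tq s'0 ns']]] := @hubless_side (rev v) (rev q).
- by rewrite rich_rev.
- exact: one_special_rev.
- exact: hubless_rev.
- by move/binary_rev.
- by rewrite prefix_rev.
- by rewrite palindrome_rev.
- by rewrite size_rev.
have {}E' : v = rev s' ++ rev t by rewrite -rev_cat -E' revK.
have {}qt : suffix q (rev t) by rewrite -prefix_revLR.
have {}tq : {subset rev t <= q} by move=> e; rewrite mem_rev => /tq; rewrite mem_rev.
have {}ns' : forall e, e \in q -> e \notin rev s' by move=> e; rewrite mem_rev -mem_rev => /ns'.
have {}s'0 : rev s' <> [::] by move/(congr1 rev); rewrite revK.
move: (rev t) (rev s') E' qt tq s'0 ns' => {}t {}s' E' qt tq s'0 ns'.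
(* A common letter [e] has neighbours [y] in [p] and [z] in [q]. If they differ, [e] is a hub; if
   they agree, the first letter of [v] lies in [q], although [s'] avoids [q]. *)
have dis e : e \in p -> e \notin q.
  move=> ep; apply/negP => eq.
  have [y [py Py]] := alternating_palindrome pp (hubless_palindrome os nh (prefixW pv) pp) ep.
  have [z [qz Qz]] := alternating_palindrome pq (hubless_palindrome os nh (suffixW qv) pq) eq.
  have [|ey ye] := Py; first by left.
  have [|ez ze] := Qz; first by left.
  have [y_z|/eqP yz] := eqVneq y z; last first.
    case/negP: (nh e).
    by apply: (two_loops_hub yz os); apply: infix_trans; try eassumption;
       exact/prefixW || exact/suffixW.
  have pq' x : x \in p -> x \in q.
    move=> /py; rewrite y_z !inE => /orP [] /eqP -> //.
    by apply: (mem_infix ez); rewrite !inE eqxx orbT.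
  case: s' s'0 E' ns' => // x s' _ E' ns'.
  suff xq : x \in q by have := ns' x xq; rewrite mem_head.
  apply: pq'; case: (p) p1 pv => // x' p'' _; rewrite E' /= => /andP [/eqP -> _].
  exact: mem_head.
have le : size s <= size s'.
  rewrite leqNgt; apply/negP => lt.
  case: (@cat_eq_split _ s' t s t'); [by rewrite -E -E'|exact: ltnW|].
  case=> [|x d] Es Et; first by rewrite Es cats0 ltnn in lt.
  have /sp /dis : x \in s by rewrite Es mem_cat mem_head orbT.
  by rewrite tq // Et mem_head.
have [z Es' Et'] := cat_eq_split (etrans (esym E) E') le.
exists s, z, t; split=> //; first by rewrite E Et'.
move=> e ez; split; apply/negP.
  by move/nt'; rewrite Et' mem_cat ez.
by move/ns'; rewrite Es' mem_cat ez orbT.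
Qed.

(** Final letters of [s] without an earlier occurrence are shifted to [t]. Then the last letter of
    [s] is followed by a letter of [t], and at an earlier occurrence by a letter of [s]. *)
Lemma branching_exit s t : ~~ uniq s -> t <> [::] -> (forall e, e \in s -> e \notin t) ->
  exists2 e, e \in s & special (s ++ t) [:: e].
Proof.
elim/last_ind: s t => // s x IH t nu t0 dis.
case: (boolP (x \in s)) => [xs|nxs]; last first.
  have [|||e es] := IH (x :: t) => //.
  - by move: nu; rewrite rcons_uniq nxs.
  - move=> e es; rewrite inE negb_or dis ?mem_rcons ?inE ?es ?orbT // andbT.
    by apply: contra nxs => /eqP <-.
  by rewrite -cat_rcons; exists e => //; rewrite mem_rcons inE es orbT.
exists x; first by rewrite mem_rcons mem_head.
have [a [b Es]] := last_split xs; case: t t0 dis => // d t _ dis.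
have [c [r Ec]] : exists c r, rcons s x = a ++ x :: c :: r.
  rewrite (proj1 Es) rcons_cat /=; case: (b) => [|c r]; first by exists x, [::].
  by exists c, (rcons r x).
apply: (@special_letter _ _ _ c d).
- move=> cd; have := dis c; rewrite Ec cd !inE eqxx.
  by rewrite mem_cat !inE eqxx !orbT => /(_ isT).
- by rewrite Ec -catA infix_catl //= !eqxx prefix0s.
- by rewrite cat_rcons infix_catl //= !eqxx prefix0s.
Qed.

(** The blocks [s] and [t] are binary, hence rich. A repetition in [z] would put a special letter in
    [z], beside the one that the recurrence of the first letter puts in [s]; so the letters of [z]
    are distinct. *)
Lemma hubless_rich v p q s z t : one_special v -> hubless v -> head_recurs v ->
  palindrome p -> palindrome q -> p <> [::] -> q <> [::] ->
  v = s ++ z ++ t -> prefix p s -> suffix q t -> {subset s <= p} -> {subset t <= q} ->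
  (forall e, e \in p -> e \notin q) -> (forall e, e \in z -> e \notin p /\ e \notin q) ->
  rich v.
Proof.
move=> os nh hr pp pq p0 q0 E ps qt sp tq dis zpq.
have [deg ch _ _] := os.
have part r u : infix r v -> palindrome r -> r <> [::] -> {subset u <= r} -> infix u v -> rich u.
  move=> rv pr r0 ur uv; case: r r0 rv pr ur => // h r _ rv pr ur.
  have [y [sub _]] := alternating_palindrome pr (hubless_palindrome os nh rv pr) (mem_head _ _).
  have sub' : {subset u <= [:: h; y]} by move=> e /ur /sub.
  by case: (binary_chain sub' (special_chain_infix uv ch)).
have sv : infix s v by rewrite E prefix_infix.
have tv : infix t v by rewrite E catA suffix_infix.
have ztv : infix (z ++ t) v by rewrite E suffix_infix.
have pv := infix_trans (prefixW ps) sv; have qv := infix_trans (suffixW qt) tv.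
have dzt e : e \in z -> e \notin t by move=> /zpq [_ eq]; apply: contra eq => /tq.
have dst e : e \in s -> e \notin z ++ t.
  move=> /sp ep; rewrite mem_cat negb_or; apply/andP; split.
    by apply/negP => /zpq []; rewrite ep.
  by apply: contra (dis e ep) => /tq.
have t0 : t <> [::] by move=> t0; move: qt; rewrite t0 suffixs0 => /eqP.
rewrite E; apply: rich_cat => //; first exact: part pv pp p0 sp sv.
apply: rich_cat => //; last exact: part qv pq q0 tq tv.
apply: rich_uniq; apply/negPn/negP => nuz.
have [x xz spx] := branching_exit nuz t0 dzt.
have nus : ~~ uniq s.
  case: s E ps dst {sv sp} => [|a s] E ps dst.
    by move: ps; rewrite prefixs0 => /eqP.
  have := hr _ _ E; rewrite mem_cat (negPf (dst a (mem_head _ _))) orbF /= => -> //.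
have [|y ys spy] := branching_exit nus _ dst; first by case: (z) xz.
have xy : x = y by apply: (ch [::]); [exact: special_infix ztv spx|rewrite E].
by have /zpq [+ _] := xz; rewrite xy sp.
Qed.

End Letters.

(** * The criterion *)

Section Criterion.
Variable T : eqType.
Implicit Types (a b c e x y : T) (u v w p q s t f g r z : seq T).

Lemma unseparatedP p q v : prefix p v -> suffix q v -> v <> [::] ->
  unseparated p q v <-> size v <= size p + size q.
Proof.
move=> /prefixP [t Et] /suffixP [s Es] v0; split.
  case=> [->|[E _]|[x [z [y [z0 -> -> ->]]]]]; rewrite ?size_cat //; last by lia.
  by rewrite {1}E leq_addr.
move=> le; case: (leqP (size p) (size s)) => [ps|sp].
  have [d Ed Et'] := cat_eq_split (etrans (esym Et) Es) ps.
  have d0 : d = [::].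
    by apply: size0nil; move: le; rewrite Es Ed !size_cat; lia.
  by constructor 1; rewrite Es Ed d0 cats0.
have [z Ep Eq] := cat_eq_split (etrans (esym Es) Et) (ltnW sp).
constructor 3; exists s, z, t; split=> //.
- by move=> z0; rewrite Ep z0 cats0 ltnn in sp.
- by rewrite Es Eq.
Qed.

Lemma rich_palindrome_prefix v : rich v -> head_recurs v -> v <> [::] ->
  exists p, [/\ prefix p v, palindrome p & 1 < size p].
Proof.
case: v => // a t rv /(_ a t erefl); rewrite -has_pred1 => at_ _.
have [s [x [r [E /eqP Ex nas]]]] := first_split at_; subst x.
have pr : prefix (a :: rcons s a) (a :: t).
  by rewrite E -cat_rcons -cat_cons prefix_prefix.
exists (a :: rcons s a); split=> //; last by rewrite /= size_rcons.
have ps := rich_return (rich_infix (prefixW pr) rv) (_ : a \notin s).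
by rewrite /palindrome rev_cons rev_rcons (eqP (ps _)) // -has_pred1.
Qed.

Lemma head_recurs_cons2 v : head_recurs v -> v <> [::] -> exists x y t, v = [:: x, y & t].
Proof.
by case: v => [|x [|y t]] // hr _; [have := hr x [::] erefl|exists x, y, t].
Qed.

Lemma successors a v : degree_le2 v ->
  exists b c, forall e, infix [:: a; e] v -> e \in [:: b; c].
Proof.
move=> deg; pose s := undup [seq e <- v | infix [:: a; e] v].
have ms e : infix [:: a; e] v -> e \in s.
  by move=> ae; rewrite mem_undup mem_filter ae (mem_infix ae) // !inE eqxx orbT.
have sm e : e \in s -> infix [:: a; e] v by rewrite mem_undup mem_filter => /andP [].
have: uniq s by apply: undup_uniq.
case: s ms sm => [|x [|y [|c s]]] ms sm us.
- by exists a, a => e /ms.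
- by exists x, x => e /ms; rewrite !inE => ->.
- by exists x, y.
have := deg _ _ _ _ (sm x _) (sm y _) (sm c _); rewrite !inE !eqxx !orbT => /(_ isT isT isT).
move: us; rewrite /= !inE !negb_or.
by case/and3P=> [/and3P [/negPf -> /negPf -> _] /andP [/negPf -> _]].
Qed.

(** Bounds the alphabet of [g] by the successors of [a], of which there are at most two even if [v]
    has many letters. *)
Lemma filled_successor a v g e : head_recurs v -> v <> [::] -> hub a v ->
  filled a v g -> e \in g -> infix [:: a; e] v.
Proof.
move=> hr v0 hv F eg.
have aeF : infix [:: a; e] (nseq (head a v != a) a ++ v ++ nseq (last a v != a) a).
  rewrite F; case/path.splitPr: eg => s t; rewrite fill_cat -cat_cons fill_cons.
  have [s' ->] : exists s', a :: fill a s = rcons s' a.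
    case: s => [|y s]; first by exists [::].
    by have [//|u ->] := @fill_nonempty _ a (y :: s); exists (a :: u).
  by rewrite cat_rcons infix_catl //= !eqxx prefix0s.
have {}aeF : infix [:: a; e] (nseq (head a v != a) a ++ v).
  move: aeF; case: (eqVneq (last a v) a) => [_|la]; rewrite [nseq (~~ _) _]/= ?cats0 //.
  rewrite cats1 -rcons_cat infix_rconsl => /orP [|//].
  rewrite -[[:: a; e]]/(rcons [:: a] e) suffix_rcons => /andP [_] /suffixP [r].
  move/(congr1 (last a)); rewrite !last_cat /=.
  by case: (v) v0 la => //= x s _ + E; rewrite E eqxx.
(* If the [a] before [e] is the one cut off, then [e] is the first letter of [v]; it recurs, and
   there the hub precedes it. *)
move: aeF; case: (eqVneq (head a v) a) => [//|ha] /= /orP [|//].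
rewrite eqxx /= => /prefixP [t Ev]; rewrite [v]Ev /= in ha hr *.
have /infixP [t1 [t2 Et]] : infix [:: e] t by rewrite infix1s; apply: hr.
have [[s x] Es] : exists sx, e :: t1 = rcons sx.1 sx.2.
  by exists (belast e t1, last e t1); rewrite -lastI.
have xe : infix [:: x; e] (e :: t).
  by rewrite Et -cat_cons Es /= cat_rcons infix_catl //= !eqxx prefix0s.
have hv' : hub a (e :: t) by rewrite -[e :: t]/([:: e] ++ t) -Ev.
have [<- //|E] := hubE hv' xe.
by rewrite E eqxx in ha.
Qed.

Lemma hub_case a v : one_special v -> head_recurs v -> v <> [::] -> hub a v ->
  [/\ rich v, head a v = a \/ last a v = a -> covers v (size v) & covers v (size v).-1].
Proof.
move=> [deg ch _ _] hr v0 hv; have [g F] := filled_exists v0 hv.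
have [b [c bc]] := successors a deg.
have sub : {subset g <= [:: b; c]} by move=> e /(filled_successor hr v0 hv F) /bc.
have [rg cg _] := binary_chain sub (filled_special_chain F ch).
by have [c1 c2 _ _] := filled_covers F v0 cg; split=> //; apply: filled_rich F rg.
Qed.

Lemma hub_second_letter a p v : hub a v -> prefix p v -> head a v <> a -> 1 < size p -> a \in p.
Proof.
move=> hv /prefixP [t Ev]; case: p Ev => [|b [|x p]] // -> in hv * => /= nb _.
have [//|->] := @hub_cat _ a [::] b x (p ++ t) hv.
by rewrite !inE eqxx orbT.
Qed.

Definition rich_criterion p q v :=
  [\/ unseparated p q v,
      exists x : T, [/\ v = p ++ [:: x] ++ q, share_letter p q & x \in Alph p \/ x \in Alph q] |
      exists u u1 Z u2 : seq T,
        [/\ v = p ++ u ++ q,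
            ~ share_letter p q,
            u = u1 ++ Z ++ u2 /\ [\/ u1 <> [::], Z <> [::] | u2 <> [::]],
            {subset Alph u1 <= Alph p} /\ {subset Alph u2 <= Alph q} &
            forall z : T, z \in Z -> z \notin p /\ z \notin q]].

Definition maximal_palindromes p q v :=
  [/\ prefix p v /\ palindrome p, suffix q v /\ palindrome q,
      forall u, prefix u v -> palindrome u -> size u <= size p &
      forall u, suffix u v -> palindrome u -> size u <= size q].

Lemma maximal_covers p q v n : maximal_palindromes p q v -> covers v n -> n <= size p + size q.
Proof.
move=> [_ _ mp mq] [p' [q' [pv qv [pp pq] le]]]; apply: leq_trans le _.
by apply: leq_add; [apply: mp|apply: mq].
Qed.

Lemma criterion_hub a p q v : one_special v -> head_recurs v -> head_recurs (rev v) ->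
  v <> [::] -> maximal_palindromes p q v -> hub a v -> rich v /\ rich_criterion p q v.
Proof.
move=> os hr hrr v0 mx hv; have [rv c1 c2] := hub_case os hr v0 hv; split=> //.
have [[pv pp] [qv pq] mp mq] := mx.
case: (leqP (size v) (size p + size q)) => [le|gt].
  by constructor 1; apply/unseparatedP.
have sz : size v = (size p + size q).+1 by have := maximal_covers mx c2; lia.
have ha : head a v <> a.
  by move=> E; have := maximal_covers mx (c1 (or_introl E)); rewrite leqNgt gt.
have la : last a v <> a.
  by move=> E; have := maximal_covers mx (c1 (or_intror E)); rewrite leqNgt gt.
have [p' [p'v pp' /leq_trans p1]] := rich_palindrome_prefix rv hr v0.
have {}p1 := p1 _ (mp _ p'v pp').
have [||q' [q'v pq' q1]] := rich_palindrome_prefix (v := rev v) _ hrr.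
- by rewrite rich_rev.
- by move/(congr1 rev); rewrite revK.
have {}q1 : 1 < size q.
  apply: leq_trans q1 _; rewrite -size_rev; apply: mq; last by rewrite palindrome_rev.
  by rewrite suffix_revLR.
case/prefixP: (pv) => t Et; case/suffixP: (qv) => s Es.
case: (@cat_eq_split _ p t s q); [by rewrite -Et|by have := congr1 size Es; rewrite size_cat; lia|].
move=> d Es' Et'; have : size d = 1.
  by have := congr1 size Et; rewrite Et' !size_cat; lia.
case: d Es' Et' => [|x [|]] // Es' Et' _.
have Ev : v = p ++ [:: x] ++ q by rewrite Et Et'.
(* The hub is the shared letter: it is next to the outer letters of [p] and [q], which differ from
   it. *)
have ap := hub_second_letter hv pv ha p1.
have aq : a \in q.
  rewrite -mem_rev; apply: (@hub_second_letter _ _ (rev v)); rewrite ?hub_rev ?size_rev //.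
  by move: la; case/lastP: (v) v0 => // r y _; rewrite rev_rcons last_rcons.
constructor 2; exists x; split=> //.
  by exists a; rewrite !mem_undup.
(* The last letter of the palindrome [p] is the first letter of [v], which is not [a]; so the next
   letter [x] is [a], a letter of [p]. *)
left; rewrite mem_undup; case: p p1 pp ap {mx mp pv Et sz gt Et' Es'} Ev => // b p _ /eqP pp ap Ev.
have E : v = rev p ++ b :: x :: q by rewrite Ev -pp rev_cons cat_rcons.
have [Eb|->//] := @hub_cat _ a (rev p) b x q (eq_ind _ (hub a) hv _ E).
by case: ha; rewrite Ev.
Qed.

Lemma longest_maximal v :
  maximal_palindromes (longest_prefix (@palindrome T) v) (longest_suffix (@palindrome T) v) v.
Proof.
have [? ? ?] := @longest_prefixP _ (@palindrome T) v isT.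
by have [? ? ?] := @longest_suffixP _ (@palindrome T) v isT.
Qed.

Lemma criterion_binary p q v : one_special v -> v <> [::] ->
  maximal_palindromes p q v -> binary v -> rich v /\ rich_criterion p q v.
Proof.
move=> [_ ch _ _] v0 mx [a [b sub]]; have [rv cv _] := binary_chain sub ch.
split=> //; constructor 1; have [[pv _] [qv _] _ _] := mx.
by apply/unseparatedP => //; apply: maximal_covers cv.
Qed.

Lemma maximal_nonempty p q v : maximal_palindromes p q v -> v <> [::] -> p <> [::] /\ q <> [::].
Proof.
move=> [_ _ mp mq] v0; split=> E.
  case: v v0 mp {mq} => // x v _ /(_ [:: x]); rewrite E palindrome1 /= eqxx prefix0s.
  by move=> /(_ isT isT).
case/lastP: v v0 mq {mp} => // v x _ /(_ [:: x]); rewrite E palindrome1 -cats1 suffix_suffix.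
by move=> /(_ isT isT).
Qed.

(** Richness splits [v] into blocks, as in (i) or (iii). Conversely, disjoint palindromes give such
    blocks, while palindromes with a common letter cannot contain all letters of [v]; this excludes
    (ii) and the rest of (i). *)
Lemma criterion_hubless p q v : one_special v -> head_recurs v -> head_recurs (rev v) ->
  v <> [::] -> maximal_palindromes p q v -> hubless v -> ~ binary v ->
  rich v <-> rich_criterion p q v.
Proof.
move=> os hr hrr v0 mx nh nb; have [[pv pp] [qv pq] mp mq] := mx.
have [p0 q0] := maximal_nonempty mx v0; split=> [rv|].
  have [p' [p'v pp' /leq_trans p1]] := rich_palindrome_prefix rv hr v0.
  have {}p1 := p1 _ (mp _ p'v pp').
  have [||q' [q'v pq' q1]] := rich_palindrome_prefix (v := rev v) _ hrr.
  - by rewrite rich_rev.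
  - by move/(congr1 rev); rewrite revK.
  have {}q1 : 1 < size q.
    apply: leq_trans q1 _; rewrite -size_rev; apply: mq; last by rewrite palindrome_rev.
    by rewrite suffix_revLR.
  have [s [z [t [E [ps qt] [sp tq] dis zpq]]]] := rich_hubless rv os nh nb pv pp p1 qv pq q1.
  case: (leqP (size v) (size p + size q)) => [le|gt].
    by constructor 1; apply/unseparatedP.
  case/prefixP: ps => u1 Es; case/suffixP: qt => u2 Et.
  constructor 3; exists (u1 ++ z ++ u2), u1, z, u2; split=> //.
  - by rewrite E Es Et !catA.
  - by case=> x []; rewrite !mem_undup => /dis /negP.
  - split=> //; case: u1 Es => [|? ?] Es; last by constructor 1.
    case: z E {zpq} => [|? ?] E; last by constructor 2.
    case: u2 Et => [|? ?] Et; last by constructor 3.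
    by move: gt; rewrite E Es Et !cats0 /= size_cat ltnn.
  - split=> x; rewrite !mem_undup => xu.
      by apply: sp; rewrite Es mem_cat xu orbT.
    by apply: tq; rewrite Et mem_cat xu.
have shared : share_letter p q -> {subset v <= p ++ q} -> rich v.
  case=> h []; rewrite !mem_undup => hp hq sub; case: nb.
  exact: shared_letter_binary os nh (prefixW pv) pp (suffixW qv) pq hp hq sub.
have disjoint s z t : v = s ++ z ++ t -> prefix p s -> suffix q t ->
    {subset s <= p} -> {subset t <= q} -> (forall e, e \in z -> e \notin p /\ e \notin q) ->
    ~ share_letter p q -> rich v.
  move=> E ps qt sp tq zpq ns; apply: (hubless_rich os nh hr pp pq p0 q0 E) => //.
  by move=> e ep; apply/negP => eq; apply: ns; exists e; rewrite !mem_undup.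
case=> [un|[x [E sh xpq]]|[u [u1 [z [u2 [E ns [Eu _] [u1p u2q] zpq]]]]]].
- case: (boolP (has (mem p) q)) => [/hasP [e eq ep]|/hasPn ns].
    apply: shared; first by exists e; rewrite !mem_undup.
    case: un => [->|[-> _]|[x [z [y [_ -> -> ->]]]]] e'; rewrite !mem_cat //; first by move=> ->.
    by case/or3P => ->; rewrite ?orbT.
  have {}ns : ~ share_letter p q.
    by case=> e []; rewrite !mem_undup => ep /ns /negP.
  case: un => [E|[E E']|[x [z [y [z0 _ Ep Eq]]]]].
  + by apply: (disjoint p [::] q) => //; [apply: prefix_refl|apply: suffix_refl].
  + case: ns; have -> : q = p by rewrite -E' E.
    by case: (p) p0 => // c p1 _; exists c; rewrite mem_undup mem_head.
  + by case: ns; case: z z0 Ep Eq => // c z _ -> ->; exists c;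
       rewrite !mem_undup !mem_cat mem_head orbT.
- apply: shared => // e; rewrite E !mem_cat inE => /or3P [->|/eqP ->|->]; rewrite ?orbT //.
  by case: xpq; rewrite mem_undup => ->; rewrite ?orbT.
- apply: (disjoint (p ++ u1) z (u2 ++ q)) => //.
  + by rewrite E Eu -!catA.
  + exact: prefix_prefix.
  + exact: suffix_suffix.
  + by move=> e; rewrite mem_cat => /orP [//|]; rewrite -mem_undup => /u1p; rewrite mem_undup.
  + by move=> e; rewrite mem_cat => /orP [|//]; rewrite -mem_undup => /u2q; rewrite mem_undup.
Qed.

(** When no letter repeats, the whole gap between [p] and [q] serves as [Z]. *)
Lemma criterion_uniq p q v : uniq v -> v <> [::] -> maximal_palindromes p q v ->
  rich_criterion p q v.
Proof.
move=> uv v0 mx; have [[pv pp] [qv pq] _ _] := mx.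
case: (leqP (size v) (size p + size q)) => [le|gt].
  by constructor 1; apply/unseparatedP.
case/prefixP: (pv) => t Et; case/suffixP: (qv) => s Es.
case: (@cat_eq_split _ p t s q); [by rewrite -Et|by have := congr1 size Es; rewrite size_cat; lia|].
move=> d Es' Et'; have Ev : v = p ++ d ++ q by rewrite Et Et'.
have d0 : d <> [::] by move=> d0; move: gt; rewrite Ev d0 size_cat ltnn.
move: uv; rewrite Ev !cat_uniq has_cat negb_or.
case/and3P=> [_ /andP [/hasPn dp /hasPn qp] /and3P [_ /hasPn qd _]].
constructor 3; exists d, [::], d, [::]; split=> //.
- by case=> e []; rewrite !mem_undup => ep /qp; rewrite /= ep.
- by split; [rewrite cats0|constructor 2].
- by move=> e ed; split; [apply: dp|apply/negP => /qd; rewrite /= ed].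
Qed.

Theorem criterion w v p q : GT_word w -> v = heart w -> maximal_palindromes p q v ->
  rich w <-> rich_criterion p q v.
Proof.
move=> gt Ev mx; have sg := GT_slow_growth gt.
have w0 : w <> [::].
  by move=> E; case: gt => [|[]]; rewrite E.
case: (ltnP (size (Alph w)) (size w)) => [lt|ge]; last first.
  have uw : uniq w by rewrite -[uniq w]negbK -ltn_size_undup -leqNgt.
  have Evw : v = w by rewrite Ev /heart ltnNge ge.
  rewrite Evw in mx *; split=> _; first exact: criterion_uniq.
  exact: rich_uniq.
have [v0 sgv hr hrr ->] := heart_reduction sg lt Ev.
have os := slow_growth_one_special sgv hr hrr.
case: (boolP (has (fun h => hub h v) v)) => [/hasP [h _ hv]|/hasPn nh].
  by have [] := criterion_hub os hr hrr v0 mx hv.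
(* Testing the letters of [v] suffices: [v] has length at least 2, and a hub belongs to its first
   factor of length 2. *)
have {}nh : hubless v.
  move=> h; apply/negP => hv; have [x [y [t E]]] := head_recurs_cons2 hr v0.
  have xy : infix [:: x; y] v by rewrite E /= !eqxx prefix0s.
  by case: (hubE hv xy) => Eh; have := nh h; rewrite hv -Eh E !inE eqxx ?orbT => /(_ isT).
have [|nb] : binary v \/ ~ binary v.
  case: (leqP (size (undup v)) 2) => [le|gt2]; [left|right].
    suff [a [b ab]] : binary (undup v) by exists a, b => e; rewrite -mem_undup => /ab.
    case: v v0 le {Ev mx sgv hr hrr os nh} => // x v' _.
    case: (undup _) => [|a [|b [|]]] // _; [by exists x, x|exists a, a => e|by exists a, b].
    by rewrite !inE => ->.
  case=> [a [b ab]]; move: gt2; rewrite ltnNge => /negP; apply.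
  apply: (@uniq_leq_size _ _ [:: a; b]); first exact: undup_uniq.
  by move=> e; rewrite mem_undup => /ab.
- by move=> bv; have [] := criterion_binary os v0 mx bv.
exact: criterion_hubless.
Qed.

End Criterion.

Theorem theorem3p12 (T : eqType) (w v p q : seq T)
    (GT_w : GT_word w)
    (v_heart : v = heart w)
    (p_lpp : p = longest_prefix (@palindrome T) v)
    (q_lps : q = longest_suffix (@palindrome T) v) :
  rich w <->
  [\/ unseparated p q v,
      exists x : T,
        [/\ v = p ++ [:: x] ++ q,
            share_letter p q &
            x \in Alph p \/ x \in Alph q] |
      exists u u1 Z u2 : seq T,
        [/\ v = p ++ u ++ q,
            ~ share_letter p q,
            u = u1 ++ Z ++ u2 /\ [\/ u1 <> [::], Z <> [::] | u2 <> [::]],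
            {subset Alph u1 <= Alph p} /\ {subset Alph u2 <= Alph q} &
            forall z : T, z \in Z -> z \notin p /\ z \notin q]].
Proof.
by apply: criterion GT_w v_heart _; rewrite p_lpp q_lps; apply: longest_maximal.
Qed.
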